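(* For every $\varepsilon > 0$, there exists a constant $c$ such that for every graph $G$ with maximum degree $\Delta$ and girth $g(G) \geq c$, we have $a'(G) \leq (2+\varepsilon)\Delta + o(\Delta)$.
   Context: All graphs are finite, undirected, and simple. An edge coloring of a graph $G$ is called an acyclic edge coloring if it is proper (adjacent edges receive different colors) and every cycle in $G$ contains edges of at least three different colors. The acyclic chromatic index $a'(G)$ is the least number of colors needed for an acyclic edge coloring of $G$. The girth $g(G)$ is the length of a shortest cycle in $G$ ($\infty$ if $G$ has no cycles). The term $o(\Delta)$ denotes a function of $\Delta$, which may depend on $\varepsilon$ (but not otherwise on $G$), whose ratio to $\Delta$ tends to $0$ as $\Delta \to \infty$. *)

(* Defs.v *)
From HB Require Import structures.
From mathcomp Require Import all_boot all_order all_algebra.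
From mathcomp Require Import boolp classical_sets reals ereal.

Set Implicit Arguments.
Unset Strict Implicit.
Unset Printing Implicit Defensive.

Record sgraph := SGraph {
  vertex :> finType;
  adj : rel vertex;
  adj_sym : symmetric adj;
  adj_irrefl : irreflexive adj }.

Definition edges (G : sgraph) : {set {set G}} :=
  [set E : {set G} | [exists x, exists y, adj x y && (E == [set x; y])]].

Definition max_degree (G : sgraph) : nat :=
  \max_(x : G) #|[set y | adj x y]|.

(* A cycle is given by its vertices in cyclic order, without repetition.  The
   size condition matters: [ucycle] also holds of the empty sequence and of
   [:: x; y] for adjacent x and y. *)
Definition is_cycle (G : sgraph) (s : seq G) : bool :=
  (2 < size s) && ucycleb (@adj G) s.

Definition cycle_edges (G : sgraph) (s : seq G) : seq {set G} :=
  [seq [set x; next s x] | x <- s].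

(* The infimum of the empty set is +oo, the girth of an acyclic graph. *)
Definition girth (R : realType) (G : sgraph) : \bar R :=
  ereal_inf [set l : \bar R |
    exists2 s : seq G, is_cycle s & l = ((size s)%:R%R)%:E]%classic.

(* Colorings are total on vertex sets; only their values on edges matter. *)
Definition proper_edge_coloring (G : sgraph) (col : {set G} -> nat) : Prop :=
  forall E F : {set G}, E \in edges G -> F \in edges G ->
    E != F -> ~~ [disjoint E & F] -> col E != col F.

Definition acyclic_edge_coloring (G : sgraph) (col : {set G} -> nat) : Prop :=
  proper_edge_coloring col /\
  forall s : seq G, is_cycle s ->
    3 <= size (undup [seq col E | E <- cycle_edges s]).

Definition acyclic_edge_colorable (G : sgraph) (k : nat) : Prop :=
  exists2 col : {set G} -> nat,
    acyclic_edge_coloring col & forall E, E \in edges G -> col E < k.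

Lemma cycle_edges_uniq (G : sgraph) (s : seq G) :
  is_cycle s -> uniq (cycle_edges s).
Proof.
case/andP=> ltss /andP[_ us]; rewrite map_inj_in_uniq // => x y xs ys eqE.
apply/eqP/negPn/negP => neq.
have : x \in [set y; next s y] by rewrite -eqE set21.
have : y \in [set x; next s x] by rewrite eqE set21.
rewrite !inE eq_sym (negPf neq) /= => /eqP yE /eqP xE.
case/rot_to: xs => i s' rs.
move: xE yE; rewrite -!(next_rot i us); move: ltss us.
rewrite -(size_rot i) -(rot_uniq i) {}rs.
case: s' => [|a [|b s']] //= _ + + yE; rewrite yE.
rewrite !inE !negb_or eqxx => /andP[/and3P[xa xb _] _].
rewrite [a == x]eq_sym (negPf xa) eqxx.
by move/eqP; rewrite (negPf xb).
Qed.

Lemma acyclic_edge_colorable_exists (G : sgraph) :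
  exists k, `[< acyclic_edge_colorable G k >].
Proof.
exists #|{set G}|; apply/asboolP; exists (fun E => enum_rank E : nat) => //.
have inj : injective (fun E : {set G} => enum_rank E : nat).
  by move=> E F /ord_inj/enum_rank_inj.
split=> [E F _ _ + _|s cs]; first by apply: contra => /eqP/inj->.
rewrite undup_id ?(map_inj_uniq inj) ?cycle_edges_uniq // !size_map.
by case/andP: cs.
Qed.

Definition acyclic_chromatic_index (G : sgraph) : nat :=
  ex_minn (acyclic_edge_colorable_exists G).

(* Main.v *)
Require Import Defs.
From HB Require Import structures.
From mathcomp Require Import all_classical all_reals all_analysis.
From mathcomp Require Import all_boot all_order all_algebra.
From mathcomp Require Import zify.

(** Write Delta for the maximum degree.  A partial edge coloring is built in two
phases, each of which is a counting argument.  For a set H of edges, let Z H be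
the total weight of the colorings of H under consideration.  One shows that
b * Z (H - e) <= Z H for each e in H, by induction on H.  Since Z is positive
on the empty set, it is positive on the set of all edges, so that a coloring
exists ([growth]).

First phase ([blank_coloring_exists]).  There are K = 2 Delta + 2 beta colors,
beta being about Delta / n with n of order 1 / eps, and edges may also stay
blank, at most D = beta of them at any vertex; a coloring with k blank edges
has weight lambda ^ k, where lambda is a small constant times Delta.  Given a
coloring of H - e, at most 2 Delta colors are forbidden for e = uv by
properness.  A further color a is bad only if some color b yields an
alternating path from u to v with colors b, a, b, ..., b, closed up by e.  The
number of such a is at most beta on average, and this is the
place where a large girth helps.  The path has many edges; making one of its
first L edges blank breaks it, and nothing is lost: the cut edge is found
again as the one between the end of the (b, a)-path from u and the end of the
(b, a)-path from v ([closing_path_cut_inj]).  So each bad pair (coloring, a)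
yields L cuts, whereas the result of a cut, together with a and b, determines
the pair.  Hence the average number of bad colors is at most
K ^ 2 / (lambda L), apart from cuts that are not allowed since a vertex near u
already has D blank edges.  The latter are exponentially rare in Delta
([weight_saturated]), because the D edges can be recolored, each in beta ways
instead of lambda.  A simple count of cycles would instead need beta >= Delta,
that is, 3 Delta colors.

Second phase ([completion_exists]).  The blank edges span a graph of maximum
degree at most D, much smaller than Delta, and get 8 D new colors.  Now the
cycles themselves can be counted.  Properness forbids 2 D colors.  A bicolored
cycle through e with 2 k edges has either two new colors, and there are at most
D ^ (2 k - 2) of these and 2 k - 3 edges other than e whose color is forced; or
a new and an old color, and there are at most Delta * D ^ (k - 2) of these,
because the old edges are forced by the old coloring, and k - 2 such edges.  Each
forced color costs a factor 2 D, so that the sums over k are geometric; since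
Delta <= 2 ^ r * D, they are small if only cycles with large k occur.

Altogether there are 2 Delta + 10 beta colors, if Delta is large enough.  For
smaller Delta the second phase, with all edges blank, gives the constant bound
that is put into the error term. *)

Set Implicit Arguments.
Unset Strict Implicit.
Unset Printing Implicit Defensive.

(** * Partial edge colorings and the paths that close a bicolored cycle *)

Lemma set2_injr (T : finType) (x y z : T) : [set x; y] = [set x; z] -> y = z.
Proof.
move=> E; have := set22 x y; rewrite E !inE => /orP[/eqP yx|/eqP//].
by have := set22 x z; rewrite -E !inE yx orbb => /eqP.
Qed.

Lemma set2_eqP (T : finType) (x y u v : T) :
  [set x; y] = [set u; v] -> (x = u /\ y = v) \/ (x = v /\ y = u).
Proof.
move=> E; have := set21 x y; rewrite E !inE => /orP[] /eqP xE; [left|right].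
  by split=> //; move: E; rewrite xE => /set2_injr.
by split=> //; move: E; rewrite xE [RHS]setUC => /set2_injr.
Qed.

Section PartialColorings.
Variables (G : sgraph) (C : eqType).
Implicit Types (f : {ffun {set G} -> option C}) (p : nat -> G).

Definition proper_partial f : Prop := forall x y z c,
  f [set x; y] = Some c -> f [set x; z] = Some c -> y = z.

Definition alt (a b : C) (i : nat) : C := if odd i then a else b.

Definition inj_upto p n : Prop :=
  forall i j, i < n -> j < n -> p i = p j -> i = j.

(** Two colors on a cycle of a proper coloring alternate, so that its length n is
even.  The bound on n excludes a single edge that is traversed back and forth. *)
Definition acyclic_partial f : Prop := forall a b p n,
  2 < n -> ~~ odd n -> inj_upto p n ->
  ~ (forall i, i < n -> f [set p i; p (i.+1 %% n)] = Some (alt a b i)).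

(** The edge uv, once it gets the color a, would close this path to a bicolored
cycle.  The colors of the path are b, a, b, ..., b, which makes m odd. *)
Definition closing_path f (a b : C) (u v : G) (p : nat -> G) (m : nat) : Prop :=
  [/\ odd m /\ 2 < m, inj_upto p m.+1, p 0 = u, p m = v &
      forall i, i < m -> f [set p i; p i.+1] = Some (alt a b i)].

Definition recolor f (E : {set G}) (o : option C) : {ffun {set G} -> option C} :=
  [ffun F => if F == E then o else f F].

Lemma recolorE f E o : recolor f E o E = o.
Proof. by rewrite ffunE eqxx. Qed.

Lemma recolor_neq f E o F : F != E -> recolor f E o F = f F.
Proof. by rewrite ffunE => /negPf->. Qed.

Lemma path_edge_inj p n i j : inj_upto p n -> i.+1 < n -> j.+1 < n ->
  [set p i; p i.+1] = [set p j; p j.+1] -> i = j.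
Proof.
move=> inj iN jN /set2_eqP[] [pi pj].
  by apply: inj => //; lia.
have := inj _ _ _ _ pi; have := inj _ _ _ _ pj; lia.
Qed.

Lemma cyclic_edge_inj p n i j : 2 < n -> inj_upto p n -> i < n -> j < n ->
  [set p i; p (i.+1 %% n)] = [set p j; p (j.+1 %% n)] -> i = j.
Proof.
move=> n2 inj iN jN; have n0 : 0 < n by lia.
case/set2_eqP=> -[pi pj]; first exact: inj.
have e1 : i = j.+1 %% n by apply: inj => //; rewrite ltn_mod.
have e2 : i.+1 %% n = j by apply: inj => //; rewrite ltn_mod.
have [jn|jn] : j.+1 < n \/ j.+1 = n by lia.
  rewrite modn_small // in e1.
  have [iin|iin] : i.+1 < n \/ i.+1 = n by lia.
    by rewrite modn_small // in e2; lia.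
  by rewrite iin modnn in e2; lia.
rewrite jn modnn in e1; rewrite e1 modn_small in e2; lia.
Qed.

Lemma proper_recolor f u v a : proper_partial f ->
  (forall x, f [set u; x] <> Some a) -> (forall x, f [set v; x] <> Some a) ->
  proper_partial (recolor f [set u; v] (Some a)).
Proof.
move=> pf fu fv x y z c; rewrite !ffunE.
case: eqP => [E1|_]; case: eqP => [E2|_].
- by move=> _ _; apply: (@set2_injr _ x); rewrite E1.
- move=> [<-] fE; have : x \in [set u; v] by rewrite -E1 set21.
  by rewrite !inE => /orP[] /eqP xE; rewrite xE in fE; [case: (fu z)|case: (fv z)].
- move=> + [ac]; rewrite -ac => fE; have : x \in [set u; v] by rewrite -E2 set21.
  by rewrite !inE => /orP[] /eqP xE; rewrite xE in fE; [case: (fu y)|case: (fv y)].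
- exact: pf.
Qed.

Lemma alt_rotate a b n t i : ~~ odd n -> t < n ->
  alt a b ((i + t.+1) %% n) = if odd t then alt a b i else alt b a i.
Proof.
move=> en tn; rewrite /alt.
have -> : odd ((i + t.+1) %% n) = odd (i + t.+1).
  by rewrite {2}(divn_eq (i + t.+1) n) oddD oddM (negPf en) andbF.
by rewrite oddD /=; case: (odd t); case: (odd i).
Qed.

Lemma closing_path_rev f a b u v p m :
  closing_path f a b u v p m -> closing_path f a b v u (fun i => p (m - i)) m.
Proof.
move=> [[om m2] inj p0 pm fp]; split=> //.
- move=> i j im jm pij; have := inj _ _ _ _ pij; lia.
- by rewrite subn0.
- by rewrite subnn.
move=> i im; have -> : m - i = (m - i.+1).+1 by lia.
rewrite setUC fp ?/alt; last by lia.
by congr (Some (if _ then a else b)); lia.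
Qed.

(** A bicolored cycle of the new coloring contains the edge uv.  Rotating the
cycle turns this edge into the last one, and reversing the rest of the cycle, if
necessary, makes it start at u. *)
Lemma acyclic_recolor f u v a : acyclic_partial f ->
  (forall b p m, ~ closing_path f a b u v p m) ->
  acyclic_partial (recolor f [set u; v] (Some a)).
Proof.
move=> af ncl a0 b0 p n n2 en inj fp; have n0 : 0 < n by lia.
case: (EM (exists2 t, t < n & [set p t; p (t.+1 %% n)] = [set u; v])); last first.
  move=> nt; apply: (af a0 b0 p n n2 en inj) => i iN; rewrite -fp //.
  by rewrite recolor_neq //; apply/eqP => Ei; apply: nt; exists i.
case=> t tn Et.
pose q i := p ((i + t.+1) %% n).
have modS i : (i + t.+1).+1 %% n = ((i + t.+1) %% n).+1 %% n.
  by rewrite -addn1 -modnDml addn1.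
(* q starts just after the edge uv, which becomes its closing edge *)
have qn : q n.-1 = p t.
  rewrite /q; have -> : n.-1 + t.+1 = t + n by lia.
  by rewrite modnDr modn_small.
have injq : inj_upto q n.-1.+1.
  rewrite prednK // => i j iN jN /inj; rewrite !ltn_mod => /(_ n0 n0)/eqP.
  by rewrite eqn_modDr !modn_small // => /eqP.
have [b fq] : exists b, forall i, i < n.-1 ->
    f [set q i; q i.+1] = Some (alt a b i).
  have aE : Some (alt a0 b0 t) = Some a by rewrite -fp // Et recolorE.
  exists (if odd t then b0 else a0) => i iN.
  have iT : (i + t.+1) %% n != t.
    have -> : i + t.+1 = t + i.+1 by lia.
    rewrite -[X in _ != X](modn_small tn) -[X in _ != X %% _]addn0 eqn_modDl.
    by rewrite !modn_small //; lia.
  have := fp _ (ltn_pmod (i + t.+1) n0).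
  rewrite -modS -addSn -/(q _) recolor_neq => [->|].
    rewrite alt_rotate //; case: aE; rewrite /alt; case: (odd t) => <- //.
  apply: contra iT => /eqP Ei; apply/eqP.
  apply: (@cyclic_edge_inj p n) => //; first by rewrite ltn_mod.
  by rewrite -modS -addSn Ei Et.
have q0 : q 0 = p (t.+1 %% n) by [].
case: (set2_eqP Et) => -[pt pt1].
  apply: (ncl b (fun i => q (n.-1 - i)) n.-1); apply: closing_path_rev.
  by split=> //; rewrite ?q0 ?qn //; split; lia.
apply: (ncl b q n.-1).
by split=> //; rewrite ?q0 ?qn //; split; lia.
Qed.

End PartialColorings.

(** * Cycles, degrees and total colorings of a graph *)

Section Graph.
Variable G : sgraph.
Implicit Types (x y u v : G) (E : {set G}).

Lemma in_edges x y : ([set x; y] \in edges G) = adj x y.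
Proof.
apply/idP/idP => [|xy]; last first.
  by rewrite inE; apply/existsP; exists x; apply/existsP; exists y; rewrite xy eqxx.
rewrite inE => /existsP[u /existsP[v /andP[uv /eqP /set2_eqP[] [-> ->]//]]].
by rewrite adj_sym.
Qed.

Lemma edgesP E : E \in edges G -> exists u v, E = [set u; v].
Proof.
by rewrite inE => /existsP[u /existsP[v /andP[_ /eqP->]]]; exists u, v.
Qed.

Lemma edges_mem E x : E \in edges G -> x \in E -> exists2 y, adj x y & E = [set x; y].
Proof.
move=> EG; have [u [v EE]] := edgesP EG.
move: EG; rewrite EE in_edges !inE => uv /orP[] /eqP->; first by exists v.
by exists u; [rewrite adj_sym|rewrite setUC].
Qed.

Definition star x : {set {set G}} := [set E in edges G | x \in E].

Lemma card_nbr x : #|[set y | adj x y]| <= max_degree G.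
Proof. exact: (@leq_bigmax _ (fun x : G => #|[set y | adj x y]|)). Qed.

Lemma card_star x : #|star x| <= max_degree G.
Proof.
apply: leq_trans (card_nbr x).
apply: leq_trans (leq_imset_card (fun y => [set x; y]) _).
apply/subset_leq_card/subsetP => E; rewrite inE => /andP[EG xE].
by have [y xy ->] := edges_mem EG xE; apply/imsetP; exists y; rewrite ?inE.
Qed.

Lemma mkseq_cycle (p : nat -> G) n : 2 < n -> inj_upto p n ->
  (forall i, i < n -> adj (p i) (p (i.+1 %% n))) -> is_cycle (mkseq p n).
Proof.
move=> n2 inj pp; rewrite /is_cycle size_mkseq n2 andTb /ucycleb; apply/andP; split; last first.
  by apply/mkseq_uniqP => i j; rewrite !inE; apply: inj.
have -> : mkseq p n = p 0 :: mkseq (fun i => p i.+1) n.-1.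
  by case: n n2 {inj pp} => // n _; rewrite /mkseq /= (iotaDl 1 0) -map_comp.
rewrite /=; apply/(pathP (p 0)) => i; rewrite size_rcons size_mkseq.
move=> iN; have {}iN : i < n by lia.
have -> : nth (p 0) (p 0 :: rcons (mkseq (fun j => p j.+1) n.-1) (p 0)) i = p i.
  case: i iN => //= i iN; rewrite nth_rcons size_mkseq.
  have iN1 : i < n.-1 by lia.
  by rewrite iN1 nth_mkseq.
have -> : nth (p 0) (rcons (mkseq (fun j => p j.+1) n.-1) (p 0)) i = p (i.+1 %% n).
  rewrite nth_rcons size_mkseq; case: ltnP => iN1.
    by rewrite nth_mkseq // modn_small //; lia.
  have -> : i.+1 = n by lia.
  by rewrite modnn; case: ifP.
exact: pp.
Qed.

End Graph.

(** Of two colors, only one can follow the other; closing the cycle forces its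
length to be even. *)
Lemma alternating_of_two_colors (T : eqType) (c : nat -> T) n : 2 < n ->
  (forall i, i < n -> c i <> c (i.+1 %% n)) ->
  size (undup (mkseq c n)) <= 2 ->
  ~~ odd n /\ forall i, i < n -> c i = alt (c 1) (c 0) i.
Proof.
move=> n2 neq le2.
have n01 : c 0 != c 1 by apply/eqP; have := neq 0; rewrite modn_small; [apply|]; lia.
have two i : i < n -> c i = c 0 \/ c i = c 1.
  move=> iN; case: (EM (c i = c 0 \/ c i = c 1)) => // /not_orP[i0 i1]; exfalso.
  move: le2; rewrite leqNgt => /negP; apply.
  apply: (@uniq_leq_size _ [:: c i; c 0; c 1]).
    rewrite /= !inE n01 !andbT; apply/norP; split; exact/eqP.
  move=> x; rewrite mem_undup !inE => /or3P[] /eqP->; apply: map_f; rewrite mem_iota; lia.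
have H i : i < n -> c i = alt (c 1) (c 0) i.
  elim: i => // i IH iN.
  have := neq i (ltnW iN); rewrite modn_small // IH ?(ltnW iN) //.
  by have := two _ iN; rewrite /alt /=; case: (odd i) => /= -[->|->].
split=> //; have nn : n.-1 < n by lia.
have := neq _ nn; rewrite (H _ nn) prednK ?modnn /alt; last by lia.
have -> : odd n.-1 = ~~ odd n by lia.
by case: (odd n).
Qed.

Lemma chromatic_index_le (G : sgraph) (C : finType) (f : {ffun {set G} -> option C}) :
  proper_partial f -> acyclic_partial f -> (forall E, E \in edges G -> f E <> None) ->
  acyclic_chromatic_index G <= #|C|.
Proof.
move=> pf af tf; rewrite /acyclic_chromatic_index; case: ex_minnP => k _; apply.
apply/asboolP.
pose col E : nat := if f E is Some c then enum_rank c else 0.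
have colE E F : E \in edges G -> F \in edges G -> col E = col F -> f E = f F.
  move=> /tf + /tf; rewrite /col; case: (f E) => // c _; case: (f F) => // d _.
  by move=> /ord_inj/enum_rank_inj->.
have pcol : proper_edge_coloring col.
  move=> E F EG FG EF /pred0Pn[x /andP[/= xE xF]]; apply: contra EF => /eqP cc.
  have := colE _ _ EG FG cc; have := tf _ EG.
  have [y xy ->] := edges_mem EG xE; have [z xz ->] := edges_mem FG xF.
  case fE : (f _) => [c|//] _ /esym fF; apply/eqP; congr [set _; _].
  exact: pf fE fF.
exists col; last first.
  by move=> E /tf; rewrite /col; case: (f E) => // c _; rewrite ltn_ord.
split=> // s cs; rewrite ltnNge; apply/negP => le2.
have /andP[s2 /andP[cys us]] := cs.
have /hasP[x0 _ _] : has predT s by rewrite has_predT; lia.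
pose n := size s; pose p i := nth x0 s i.
have nxt i : i < n -> next s (p i) = p (i.+1 %% n).
  move=> iN; rewrite next_nth mem_nth //.
  rewrite /p /n; rewrite /n in iN; clear -us iN x0; case: s us iN => // y s us iN.
  rewrite index_uniq //=; rewrite ltnS leq_eqVlt in iN.
  case/predU1P: iN => [->|iN].
    by rewrite modnn nth_default //.
  by rewrite modn_small //=; apply: set_nth_default.
have adjp i : i < n -> [set p i; p (i.+1 %% n)] \in edges G.
  move=> iN; rewrite in_edges -nxt //; apply: (next_cycle cys); exact: mem_nth.
have inj : inj_upto p n.
  by move=> i j iN jN /eqP; rewrite nth_uniq // => /eqP.
pose c i := col [set p i; p (i.+1 %% n)].
have ms : mkseq c n = [seq col E | E <- cycle_edges s].
  apply: (@eq_from_nth _ 0) => [|i]; rewrite size_mkseq ?size_map // => iN.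
  by rewrite nth_mkseq // (nth_map set0) ?size_map // (nth_map x0) // nxt.
have nm i : i %% n < n by apply: ltn_pmod; rewrite /n; lia.
(* consecutive edges of the cycle share the vertex between them *)
have neq i : i < n -> c i <> c (i.+1 %% n).
  move=> iN; apply/eqP/pcol; rewrite ?adjp //.
    apply/eqP => /(cyclic_edge_inj s2 inj iN (nm _)).
    have [i1|i1] : i.+1 < n \/ i.+1 = n by lia.
      by rewrite modn_small //; lia.
    by rewrite i1 modnn; lia.
  by apply/pred0Pn; exists (p (i.+1 %% n)); rewrite /= set22 set21.
rewrite -ms in le2; have [en alc] := alternating_of_two_colors s2 neq le2.
have m1 : 1 %% n = 1 by rewrite modn_small //; lia.
have m2 : 2 %% n = 2 by rewrite modn_small.
have e0 : [set p 0; p 1] \in edges G by rewrite -m1 adjp //; lia.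
have e1 : [set p 1; p 2] \in edges G by rewrite -m2 adjp //; lia.
have H i : i < n -> f [set p i; p (i.+1 %% n)] =
    if odd i then f [set p 1; p 2] else f [set p 0; p 1].
  move=> iN; have := alc i iN; rewrite /alt /c m1 m2.
  by case: (odd i) => /colE -> //; rewrite adjp.
case f0 : (f [set p 0; p 1]) (tf _ e0) => [b|//] _.
case f1 : (f [set p 1; p 2]) (tf _ e1) => [a|//] _.
apply: (af a b p n s2 en inj) => i iN; rewrite H // f0 f1 /alt; by case: (odd i).
Qed.

(** * Weighted counting *)

(** The induction behind both counting arguments.  In the step from H - e to H,
the effect of removing any further set A from H - e is already known: this
bounds the number of colorings whose values on A are forced. *)
Lemma growth (T : finType) (Z : {set T} -> nat) (b : nat) (U : {set T}) :
  (forall (H : {set T}) e, H \subset U -> e \in H ->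
     (forall A : {set T}, A \subset H :\ e ->
        b ^ #|A| * Z ((H :\ e) :\: A) <= Z (H :\ e)) ->
     b * Z (H :\ e) <= Z H) ->
  forall H A : {set T}, H \subset U -> A \subset H -> b ^ #|A| * Z (H :\: A) <= Z H.
Proof.
move=> step H; have [n leHn] := ubnP #|H|; elim: n H leHn => // n IH H leHn A HU AH.
have [->|[e eA]] := set_0Vmem A; first by rewrite cards0 mul1n setD0.
have eH := subsetP AH _ eA.
have sub : H :\ e \subset U by apply: subset_trans HU; exact: subsetDl.
have ltn : #|H :\ e| < n by move: leHn; rewrite (cardsD1 e H) eH.
have -> : H :\: A = (H :\ e) :\: (A :\ e).
  by apply/setP => x; rewrite !inE; case: eqP => [->|]; rewrite ?eA.
rewrite (cardsD1 e A) eA expnD expn1 -mulnA.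
apply: leq_trans (step H e HU eH _); last by move=> A' A'H; apply: IH.
by rewrite leq_mul2l IH ?orbT // setSD.
Qed.

Lemma leq_sum_inj (S T : finType) (X : {pred S}) (Y : {pred T})
    (F : S -> nat) (K : T -> nat) (phi : S -> T) :
  {in X &, injective phi} -> {in X, forall x, phi x \in Y} ->
  {in X, forall x, F x <= K (phi x)} ->
  \sum_(x in X) F x <= \sum_(y in Y) K y.
Proof.
move=> inj im le; apply: (@leq_trans (\sum_(x in X) K (phi x))).
  exact: leq_sum.
rewrite -(big_imset K inj) [leqRHS](bigID (mem (phi @: X))) /=.
apply: leq_trans (leq_addr _ _); rewrite [leqRHS](eq_bigl (mem (phi @: X))) //.
move=> y /=; case yX : (y \in phi @: X); rewrite ?andbF //.
by case/imsetP: yX => x xX ->; rewrite im.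
Qed.

Lemma sum_dep_pairs (S T : finType) (A : {set S}) (P : S -> T -> bool) (w : S -> nat) :
  \sum_(x in [set x : S * T | (x.1 \in A) && P x.1 x.2]) w x.1 =
  \sum_(h in A) w h * #|[set a | P h a]|.
Proof.
rewrite (eq_bigl (fun x => (x.1 \in A) && P x.1 x.2)); last first.
  by move=> x; rewrite inE.
rewrite -(pair_big_dep (mem A) P (fun h _ => w h)) /=.
apply: eq_bigr => h _; rewrite sum_nat_const mulnC; congr (_ * _).
by apply: eq_card => a; rewrite !inE.
Qed.

Lemma card_dep_pairs (S T : finType) (A : {set S}) (P : S -> T -> bool) :
  #|[set x : S * T | (x.1 \in A) && P x.1 x.2]| = \sum_(h in A) #|[set a | P h a]|.
Proof.
by rewrite -sum1_card (sum_dep_pairs _ _ (fun=> 1)); apply: eq_bigr => h _; rewrite mul1n.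
Qed.

Lemma in_setXT (S T : finType) (A : {set S}) (x : S * T) :
  (x \in setX A [set: T]) = (x.1 \in A).
Proof. by case: x => a b; rewrite in_setX in_setT andbT. Qed.

Lemma sum_setXT (S T : finType) (A : {set S}) (w : S -> nat) :
  \sum_(x in setX A [set: T]) w x.1 = #|T| * \sum_(h in A) w h.
Proof.
rewrite (eq_bigl (fun x => (x.1 \in A) && true)); last by move=> x; rewrite in_setXT andbT.
rewrite -(pair_big_dep (mem A) (fun _ _ => true) (fun h _ => w h)) /= big_distrr /=.
by apply: eq_bigr => h _; rewrite sum_nat_const.
Qed.

Lemma leq_sum_setU (T : finType) (A B : {set T}) (F : T -> nat) :
  \sum_(x in A :|: B) F x <= \sum_(x in A) F x + \sum_(x in B) F x.
Proof.
rewrite big_mkcond [X in _ <= X + _]big_mkcond [X in _ <= _ + X]big_mkcond -big_split.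
by apply: leq_sum => x _; rewrite in_setU; case: (x \in A); rewrite ?leq_addr.
Qed.

Lemma leq_sum_cover (S T : finType) (A : {set S}) (B : {set T}) (P : S -> T -> bool)
    (F : S -> nat) : (forall x, x \in A -> exists2 y, y \in B & P x y) ->
  \sum_(x in A) F x <= \sum_(y in B) \sum_(x | P x y) F x.
Proof.
move=> cover; rewrite (exchange_big_dep predT) //= [leqLHS]big_mkcond.
apply: leq_sum => x _; case: ifP => // /cover[y yB xy].
by rewrite (bigD1 y) ?yB // leq_addr.
Qed.

Lemma leq_sum_sub (T : finType) (A B : {set T}) (F : T -> nat) :
  A \subset B -> \sum_(x in A) F x <= \sum_(x in B) F x.
Proof.
move=> /subsetP AB; apply: (@leq_sum_inj _ _ _ _ F F id) => //.
Qed.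

Lemma sum_geometric (y : nat -> nat) (X n : nat) :
  (forall k, k < n -> 2 ^ k * y k <= X) -> \sum_(k < n) y k <= 2 * X.
Proof.
move=> H; have : 2 ^ n * (\sum_(k < n) y k) + 2 * X <= 2 ^ n.+1 * X.
  elim: n H => [|n IH] H; first by rewrite big_ord0; lia.
  have /IH {}IH : forall k, k < n -> 2 ^ k * y k <= X by move=> k kn; apply: H; lia.
  rewrite big_ord_recr /= mulnDr; have := H n (leqnn _); move: IH; rewrite !expnS.
  by move: (2 ^ n) (\sum_(i < n) y i) (y n) => w S z; nia.
have w0 : 0 < 2 ^ n by rewrite expn_gt0.
rewrite expnS => H1; rewrite -(leq_pmul2l w0).
by move: H1; move: w0; move: (2 ^ n) (\sum_(i < n) y i) => w S; nia.
Qed.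

(** The number of sequences is bounded by the choices left for each next entry.
The result is a list, so that union bounds do not involve a finite type of
sequences. *)
Lemma extensions_list (T : finType) (Q : seq T -> Prop) (d : nat -> nat) n :
  (forall t x, Q (rcons t x) -> Q t) ->
  (forall t, size t < n -> #|[set x | `[< Q (rcons t x) >]]| <= d (size t)) ->
  exists2 L : seq (seq T), size L <= \prod_(i < n) d i &
    forall t, size t = n -> Q t -> t \in L.
Proof.
move=> Qpre; elim: n => [|n IH] Qd.
  by exists [:: [::]]; rewrite ?big_ord0 // => t /size0nil->.
have [t tn|L szL LP] := IH; first by apply: Qd; lia.
pose nexts t := [seq rcons t x | x <- enum [set x | `[< Q (rcons t x) >]]].
exists (flatten [seq nexts t | t <- L & size t == n]); last first.
  move=> t; case/lastP: t => // t x; rewrite size_rcons => -[tn] Qt.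
  apply/flatten_mapP; exists t; first by rewrite mem_filter tn eqxx LP //; apply: Qpre Qt.
  by apply: map_f; rewrite mem_enum inE; apply/asboolP.
rewrite big_ord_recr /= size_flatten /shape -map_comp sumnE big_map big_filter.
apply: (@leq_trans (\sum_(t <- L | size t == n) d n)).
  by apply: leq_sum => t /eqP tn /=; rewrite size_map -cardE -tn; apply: Qd; lia.
rewrite big_const_seq iter_addn_0 mulnC leq_mul2r.
by rewrite (leq_trans (count_size _ _) szL) orbT.
Qed.

(** * Erasing colors and counting the colors at a vertex *)

(** Distinct colors at w lead to distinct neighbors.  The tag allows counting the
colors of one kind only. *)
Lemma card_colors_at (G : sgraph) (C : eqType) (T : finType) (tag : T -> C)
    (f : {ffun {set G} -> option C}) (w : G) (S : {set G}) : injective tag ->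
  (forall y a, f [set w; y] = Some (tag a) -> y \in S) ->
  #|[set a | [exists y, f [set w; y] == Some (tag a)]]| <= #|S|.
Proof.
move=> tinj fS; pose nb a := odflt w [pick y | f [set w; y] == Some (tag a)].
have nbP a : [exists y, f [set w; y] == Some (tag a)] -> f [set w; nb a] = Some (tag a).
  by move=> /existsP[y hy]; rewrite /nb; case: pickP => [z /eqP//|/(_ y)]; rewrite hy.
rewrite -(@card_in_imset _ _ nb).
  by apply/subset_leq_card/subsetP => y /imsetP[a]; rewrite inE => /nbP/fS + ->.
move=> a b; rewrite !inE => /nbP ha /nbP hb ab; move: ha; rewrite ab hb.
by case=> /tinj.
Qed.

Section Erase.
Variables (G : sgraph) (C : eqType).
Implicit Types (f h : {ffun {set G} -> option C}).

Definition erase (A : {set {set G}}) f : {ffun {set G} -> option C} :=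
  [ffun E => if E \in A then None else f E].

Lemma proper_erase A f : proper_partial f -> proper_partial (erase A f).
Proof. by move=> pf x y z c; rewrite !ffunE; case: ifP => // _; case: ifP => // _; exact: pf. Qed.

Lemma acyclic_erase A f : acyclic_partial f -> acyclic_partial (erase A f).
Proof.
move=> af a b p n n2 en inj fp; apply: (af a b p n) => // i iN; have := fp i iN.
by rewrite ffunE; case: ifP.
Qed.

Lemma closing_path_size f e a b u v p m c : (forall E, f E <> None -> E \in edges G) ->
  e \in edges G -> e = [set u; v] -> (forall s : seq G, is_cycle s -> c <= size s) ->
  closing_path f a b u v p m -> c <= m.+1.
Proof.
move=> sf eG eE girth [[om m2] inj p0 pm fp].
suff /girth : is_cycle (mkseq p m.+1) by rewrite size_mkseq.
apply: mkseq_cycle => // [|i iN]; first by lia.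
have [im|im] : i < m \/ i = m by lia.
  by rewrite modn_small // -in_edges; apply: sf; rewrite fp.
by rewrite im modnn pm p0 -in_edges setUC -eE.
Qed.

End Erase.

(** * Coloring the blank edges with new colors *)

Section Completion.
Variables (G : sgraph) (C : finType) (f0 : {ffun {set G} -> option C}) (D r : nat).
Hypothesis D_gt0 : 0 < D.
Hypothesis pf0 : proper_partial f0.
Hypothesis af0 : acyclic_partial f0.
Hypothesis sf0 : forall E, f0 E <> None -> E \in edges G.
Let B := [set E in edges G | f0 E == None].
Hypothesis degB : forall x : G, #|[set E in B | x \in E]| <= D.
Hypothesis degG : max_degree G <= 2 ^ r * D.
Hypothesis longG : forall s : seq G, is_cycle s -> 2 * r + 4 <= size s.

Let M := 8 * D.
Let CC := (C + 'I_M)%type.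
Implicit Types (H A : {set {set G}}) (h : {ffun {set G} -> option CC}).

Let old (o : option C) : option CC := omap inl o.
Let isnew (o : option CC) : bool := if o is Some (inr _) then true else false.

Definition completions H : {set {ffun {set G} -> option CC}} :=
  [set h | `[< proper_partial h /\ acyclic_partial h >] &&
     [forall E, if E \in H then isnew (h E) else h E == old (f0 E)]].

Lemma completionsP H h : reflect
  [/\ proper_partial h, acyclic_partial h,
      forall E, E \in H -> exists a, h E = Some (inr a) &
      forall E, E \notin H -> h E = old (f0 E)]
  (h \in completions H).
Proof.
rewrite inE; apply: (iffP andP) => [[/asboolP[ph ah] /forallP hE]|[ph ah hn ho]].
  split=> // E EH; have := hE E; first by rewrite EH; case: (h E) => [[]|] // a; exists a.
  by rewrite (negPf EH) => /eqP.
split; first by apply/asboolP.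
apply/forallP => E; case: ifP => EH; first by have [a ->] := hn E EH.
by rewrite ho ?EH.
Qed.

Lemma completion_supp H h E : H \subset B -> h \in completions H ->
  h E <> None -> E \in edges G.
Proof.
move=> HB /completionsP[_ _ hn ho]; case EH : (E \in H).
  by move=> _; have := subsetP HB _ EH; rewrite inE => /andP[].
by rewrite ho ?EH //; case f0E : (f0 E) => [a|//] _; apply: sf0; rewrite f0E.
Qed.

Lemma completion_new H h E a : h \in completions H -> h E = Some (inr a) -> E \in H.
Proof.
move=> /completionsP[_ _ _ ho] hE; apply/negPn/negP => EH.
by move: (ho _ EH); rewrite hE; case: (f0 E).
Qed.

Lemma completion_old H h E a : h \in completions H -> h E = Some (inl a) -> f0 E = Some a.
Proof.
move=> /completionsP[_ _ hn ho] hE; case EH : (E \in H).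
  by have [b] := hn _ EH; rewrite hE.
by move: (ho E); rewrite EH hE => /(_ isT); case: (f0 E) => //= b [->].
Qed.

Section OneNewColor.
Variables (H : {set {set G}}) (e : {set G}) (u v : G).
Hypothesis HB : H \subset B.
Hypothesis eH : e \in H.
Hypothesis eE : e = [set u; v].
Let H' := H :\ e.
Let N := #|completions H'|.
Hypothesis IH : forall A, A \subset H' -> (2 * D) ^ #|A| * #|completions (H' :\: A)| <= N.

Let H'B : H' \subset B. Proof. by apply: subset_trans HB; exact: subsetDl. Qed.

Let cpath (t : seq G) (i : nat) : G := nth v (u :: t) i.

Definition closing_on (t : seq G) (x : {ffun {set G} -> option CC} * 'I_M) : Prop :=
  x.1 \in completions H' /\
  exists b, closing_path x.1 (inr x.2) b u v (cpath t) (size t).+1.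

(** The first two edges of the path are not erased, and they show both colors, so
that the values on the erased edges can be restored.  The erased colorings are
counted by the induction hypothesis. *)
Lemma card_closing_on (t : seq G) (Is : seq nat) (X : {set {ffun {set G} -> option CC} * 'I_M}) :
  uniq Is -> (forall i, i \in Is -> 1 < i < (size t).+1) ->
  (forall x, x \in X -> closing_on t x) ->
  (forall i, i \in Is -> X != set0 -> [set cpath t i; cpath t i.+1] \in H') ->
  (2 * D) ^ size Is * #|X| <= N.
Proof.
move=> uI rI Xcl XI; have [->|/[dup] X0 /set0Pn[x0 x0X]] := eqVneq X set0.
  by rewrite cards0 muln0.
set m := (size t).+1 in rI; set p := cpath t.
have [m2 injp] : 2 < m /\ inj_upto p m.+1 by have [_ [b []]] := Xcl _ x0X => -[].
pose A : {set {set G}} := [set E in [seq [set p i; p i.+1] | i <- Is]].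
have AP E : E \in A -> exists2 i, 1 < i < m & E = [set p i; p i.+1].
  by rewrite inE => /mapP[i iI ->]; exists i; rewrite ?rI.
have AH : A \subset H'.
  by apply/subsetP => E; rewrite inE => /mapP[i iI ->]; apply: XI.
have cA : #|A| = size Is.
  rewrite cardsE (card_uniqP _) ?size_map // map_inj_in_uniq // => i j iI jI.
  have /andP[_ im] := rI i iI; have /andP[_ jm] := rI j jI.
  by apply: (path_edge_inj injp).
have [m0 m1] : 0 < m /\ 1 < m by split; rewrite // ltnW.
have A0 : [set p 0; p 1] \notin A.
  apply/negP => /AP[i /andP[i1 im] /(path_edge_inj injp)].
  by rewrite !ltnS => /(_ m0 im) i0; rewrite -i0 in i1.
have A1 : [set p 1; p 2] \notin A.
  apply/negP => /AP[i /andP[i1 im] /(path_edge_inj injp)].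
  by rewrite !ltnS => /(_ m1 im) i0; rewrite -i0 in i1.
rewrite -cA; apply: leq_trans (IH AH); rewrite leq_mul2l; apply/orP; right.
pose phi (x : {ffun {set G} -> option CC} * 'I_M) := erase A x.1.
rewrite -(@card_in_imset _ _ phi); first apply/subset_leq_card/subsetP.
  move=> _ /imsetP[x xX ->]; have [/completionsP[ph ah hn ho] _] := Xcl _ xX.
  apply/completionsP; split; [exact: proper_erase|exact: acyclic_erase| |] => E.
    by rewrite !inE ffunE => /andP[/negPf EA EH]; rewrite inE EA; apply: hn; rewrite !inE.
  rewrite in_setD ffunE; case: ifP => [EA _|EA /= EH]; last exact: ho.
  have := subsetP (subset_trans AH H'B) _ EA.
  by rewrite inE => /andP[_ /eqP->].
move=> [h a] [h' a'] xX yX /ffunP eqh.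
have [hW [b [_ _ p0 pm hp]]] := Xcl _ xX.
have [h'W [b' [_ _ _ _ hp']]] := Xcl _ yX.
rewrite /= -/p -/m in hW h'W hp hp' p0 pm *.
have := eqh [set p 1; p 2]; rewrite !ffunE (negPf A1) hp ?hp' ?/alt //=.
move=> [aa]; have := eqh [set p 0; p 1]; rewrite !ffunE (negPf A0) hp ?hp' ?/alt //=.
move=> [bb]; congr (_, _) => //; apply/ffunP => E.
have := eqh E; rewrite !ffunE; case: ifP => // EA _.
have [i /andP[_ im] ->] := AP E EA; rewrite hp // hp' // /alt.
by rewrite aa bb.
Qed.

(** The flag tells whether the second color b of the cycle is old or new. *)
Definition closing_pairs (m : nat) (mixed : bool) : {set {ffun {set G} -> option CC} * 'I_M} :=
  [set x | (x.1 \in completions H') &&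
    `[< exists b p, closing_path x.1 (inr x.2) b u v p m /\
          (if b is inl _ then true else false) = mixed >]].

Lemma cpath_mkseq p m : 0 < m -> p 0 = u -> p m = v -> forall i, i <= m ->
  cpath (mkseq (fun j => p j.+1) m.-1) i = p i.
Proof.
move=> m0 p0 pm [//|i] im; rewrite /cpath /=.
have [i1|i1] : i < m.-1 \/ i.+1 = m by lia.
  by rewrite nth_mkseq.
by rewrite nth_default ?size_mkseq ?i1 //; lia.
Qed.

Lemma closing_pairs_cover m mixed x : 0 < m -> x \in closing_pairs m mixed ->
  exists t b, [/\ size t = m.-1, x.1 \in completions H',
    closing_path x.1 (inr x.2) b u v (cpath t) m &
    (if b is inl _ then true else false) = mixed].
Proof.
move=> m0; rewrite inE => /andP[xW /asboolP[b [p [[om inj p0 pm hp] bm]]]].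
exists (mkseq (fun j => p j.+1) m.-1), b; have pE := cpath_mkseq m0 p0 pm.
split; rewrite ?size_mkseq //; split=> //; rewrite ?pE //.
  by move=> i j im jm; rewrite !pE //; apply: inj.
by move=> i im; rewrite !pE ?hp // ltnW.
Qed.

(** A union bound over the sequences t of inner vertices of the path.  Here Q
collects what is known about t without the new coloring, d bounds the choices for
the next vertex that Q leaves, and Is lists the positions of the edges to erase,
which have new colors. *)
Lemma card_closing_pairs m mixed (Q : seq G -> Prop) (d : nat -> nat) (Is : seq nat) :
  2 < m -> uniq Is -> (forall i, i \in Is -> 1 < i < m) ->
  (forall t x, Q (rcons t x) -> Q t) ->
  (forall t, size t < m.-1 -> #|[set x | `[< Q (rcons t x) >]]| <= d (size t)) ->
  (forall t h a b, size t = m.-1 -> h \in completions H' ->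
     closing_path h (inr a) b u v (cpath t) m ->
     (if b is inl _ then true else false) = mixed -> Q t /\
     forall i, i \in Is -> [set cpath t i; cpath t i.+1] \in H') ->
  (2 * D) ^ size Is * #|closing_pairs m mixed| <= (\prod_(i < m.-1) d i) * N.
Proof.
move=> m2 uI rI Qpre Qd QP; have [L szL LP] := extensions_list Qpre Qd.
pose X t := [set x in closing_pairs m mixed | (size t == m.-1) &&
  `[< exists2 b, closing_path x.1 (inr x.2) b u v (cpath t) m &
      (if b is inl _ then true else false) = mixed >]].
have cX t : (2 * D) ^ size Is * #|X t| <= N.
  have [tm|tm] := eqVneq (size t) m.-1; last first.
    suff -> : X t = set0 by rewrite cards0 muln0.
    by apply/setP => x; rewrite !inE (negPf tm) /= andbF.
  have tm1 : (size t).+1 = m by lia.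
  apply: (@card_closing_on t) => // [i|x|i iI /set0Pn[x]].
  - by rewrite tm1; apply: rI.
  - rewrite inE => /andP[+ /andP[_ /asboolP[b cl _]]]; rewrite inE => /andP[xW _].
    by split=> //; exists b; rewrite tm1.
  rewrite inE => /andP[+ /andP[_ /asboolP[b cl bm]]]; rewrite inE => /andP[xW _].
  by have [_ ] := QP _ _ _ _ tm xW cl bm; apply.
apply: (@leq_trans (\sum_(t <- L) (2 * D) ^ size Is * #|X t|)); last first.
  apply: (@leq_trans (\sum_(t <- L) N)); first exact: leq_sum.
  by rewrite big_const_seq iter_addn_0 count_predT mulnC leq_mul2r szL orbT.
rewrite -big_distrr /= leq_mul2l; apply/orP; right.
apply: (@leq_trans #|\bigcup_(t <- L) X t|); last first.
  elim/big_rec2: _ => [|t n S _ le]; first by rewrite cards0.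
  by rewrite (leq_trans (leq_card_setU _ _)) // leq_add2l.
apply/subset_leq_card/subsetP => x xX.
have [t [b [tm xW cl bm]]] := closing_pairs_cover (ltnW (ltnW m2)) xX.
have [Qt _] := QP _ _ _ _ tm xW cl bm.
rewrite (big_rem t) /=; last exact: LP.
rewrite inE; apply/orP; left; rewrite inE xX tm eqxx /=.
by apply/asboolP; exists b.
Qed.

Lemma cpath_rcons t x i : i <= size t -> cpath (rcons t x) i = cpath t i.
Proof.
case: i => // i it; rewrite /cpath /= nth_rcons it.
by apply: set_nth_default.
Qed.

Lemma cpath_last t x : cpath (rcons t x) (size t).+1 = x.
Proof. by rewrite /cpath /= nth_rcons ltnn eqxx. Qed.

Lemma card_new_nbr w : #|[set x | [set w; x] \in B]| <= D.
Proof.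
apply: leq_trans (degB w).
rewrite -(@card_in_imset _ _ (fun x => [set w; x])); last first.
  by move=> x y _ _ /set2_injr.
apply/subset_leq_card/subsetP => E /imsetP[x]; rewrite inE => wx ->.
by rewrite inE wx set21.
Qed.

(** The choices for the successive inner vertices of a path with one old and one
new color: the first is any of the at most 2 ^ r * D neighbors of u; after that,
an old edge is forced by its color and a new one leaves D choices, except for the
last vertex, which is forced as it is joined to v by an old edge of known
color. *)
Lemma prod_mixed q : \prod_(i < (q.*2).+2)
  (if i == 0 :> nat then 2 ^ r * D else if odd i && (i != (q.*2).+1 :> nat) then D else 1)
  = 2 ^ r * D * D ^ q.
Proof.
rewrite big_ord_recr /= eqxx andbF muln1.
elim: q => [|q IHq]; first by rewrite big_ord_recl big_ord0.
rewrite doubleS 2!big_ord_recr /= odd_double /= muln1.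
have -> : (q.*2).+1 != (q.*2).+3 by rewrite neq_ltn !ltnS leqnSn.
rewrite expnSr mulnA -IHq; congr (_ * _); apply: eq_bigr => i _.
case: eqP => // _; have := ltn_ord i; case: (odd i) => //= iq.
by rewrite !neq_ltn iq; have -> : i < (q.*2).+3 by apply: ltn_trans iq _; rewrite !ltnS leqW.
Qed.

(** The inner vertices can be chosen in Delta * D ^ q ways, with q = k + r, while q
edges have the new color a besides the first such edge.  The resulting
factor Delta / 2 ^ q is at most D / 2 ^ k. *)
Lemma card_mixed k : 2 ^ k * #|closing_pairs ((k + r).*2.+3) true| <= D * N.
Proof.
set q := k + r; set m := (q.*2).+3.
pose Q t := (forall i, i < size t ->
    if odd i then is_true ([set cpath t i; cpath t i.+1] \in B) else
      exists c, f0 [set cpath t 0; cpath t 1] = Some c /\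
                f0 [set cpath t i; cpath t i.+1] = Some c) /\
  (m.-1 <= size t -> exists c, f0 [set cpath t 0; cpath t 1] = Some c /\
                               f0 [set v; cpath t m.-1] = Some c).
(* d i counts the choices for vertex i.+1, that is, for the edge at position i *)
pose d i := if i == 0 then 2 ^ r * D else if odd i && (i != (q.*2).+1) then D else 1.
(* the edges of color a, except the one at position 1 *)
pose Is := [seq (j.*2).+3 | j <- iota 0 q].
have Isd i : i \in Is -> odd i && (1 < i < m).
  case/mapP => j; rewrite mem_iota /= add0n => jq ->.
  by rewrite /= odd_double /= /m !ltnS ltn_double.
have le : (2 * D) ^ size Is * #|closing_pairs m true| <= (\prod_(i < m.-1) d i) * N.
  apply: (@card_closing_pairs m true Q) => //.
  - rewrite map_inj_uniq ?iota_uniq // => i j [] /eqP.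
    by rewrite -!muln2 eqn_pmul2r // => /eqP.
  - by move=> i /Isd/andP[].
  - move=> t x [Q1 Q2]; split=> [i it|mt].
      have := Q1 i; rewrite size_rcons ltnS => /(_ (ltnW it)).
      by rewrite !cpath_rcons // ?(leq_trans _ it).
    have := Q2; rewrite size_rcons => /(_ (leqW mt)).
    by rewrite !cpath_rcons // (leq_trans _ mt).
  - move=> t tm; rewrite /d; case: ifP => [/eqP t0|t0].
      apply: leq_trans degG; apply: leq_trans (card_nbr u).
      apply/subset_leq_card/subsetP => x; rewrite !inE => /asboolP[Q1 _].
      have := Q1 0; rewrite size_rcons t0 => /(_ isT) /= [c [_ fc]].
      have := @sf0 [set u; x]; rewrite in_edges; apply.
      have cx : cpath (rcons t x) 1 = x by have := cpath_last t x; rewrite t0.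
      by move: fc; rewrite cpath_rcons // cx => ->.
    case: ifP => [/andP[ot _]|].
      apply: leq_trans (card_new_nbr (cpath t (size t))).
      apply/subset_leq_card/subsetP => x; rewrite in_set [in X in _ -> X]in_set => /asboolP[Q1 _].
      have := Q1 (size t); rewrite size_rcons => /(_ (leqnn _)).
      by rewrite ot cpath_rcons // cpath_last.
    move=> ot; apply/card_le1_eqP => x y; rewrite !inE.
    have t1 : 0 < size t by rewrite lt0n t0.
    move=> /asboolP[Q1x Q2x] /asboolP[Q1y Q2y].
    move/negbT: ot; rewrite negb_and negbK => /orP[et|/eqP tq].
      have := Q1x (size t); rewrite size_rcons => /(_ (leqnn _)).
      have := Q1y (size t); rewrite size_rcons => /(_ (leqnn _)).
      rewrite (negPf et) !cpath_last !cpath_rcons //.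
      by move=> [c [-> fy]] [c' [[<-] fx]]; apply: pf0 fy fx.
    have := Q2x; rewrite size_rcons tq => /(_ (leqnn _)).
    have := Q2y; rewrite size_rcons tq => /(_ (leqnn _)).
    have lastE z : cpath (rcons t z) m.-1 = z by have := cpath_last t z; rewrite tq.
    rewrite !lastE !cpath_rcons //.
    by move=> [c [-> fy]] [c' [[<-] fx]]; apply: pf0 fy fx.
  move=> t h a b tm hW [_ _ _ pm hp]; case: b hp => [c|//] hp _.
  have fc i : i < m -> ~~ odd i -> f0 [set cpath t i; cpath t i.+1] = Some c.
    by move=> im oi; apply: (completion_old hW); rewrite hp // /alt (negPf oi).
  have nc i : i < m -> odd i -> [set cpath t i; cpath t i.+1] \in H'.
    by move=> im oi; apply: (completion_new hW (a := a)); rewrite hp // /alt oi.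
  split; last by move=> i /Isd/andP[oi /andP[_ im]]; apply: nc.
  split=> [i it|_]; last first.
    exists c; rewrite fc //; split=> //; rewrite setUC.
    by have := fc m.-1; rewrite /= pm => -> //=; rewrite odd_double.
  have im : i < m by rewrite tm in it; apply: ltn_trans it _.
  case: ifP => oi; first by apply: (subsetP H'B); apply: nc.
  by exists c; rewrite !fc ?oi.
move: le; rewrite size_map size_iota prod_mixed expnMn /q (expnD 2).
have : 0 < 2 ^ r * D ^ (k + r) by rewrite muln_gt0 !expn_gt0 D_gt0.
move: (2 ^ r) (2 ^ k) (D ^ (k + r)) #|_| N D => x y z w n d0; clear => w0 le.
by rewrite -(leq_pmul2l w0); apply: leq_trans (leq_trans le _); apply: eq_leq; lia.
Qed.

(** The m - 1 inner vertices can be chosen in D ^ (m - 1) ways; the edges other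
than the first two give the factor (2 D) ^ (m - 2). *)
Lemma card_pure k : 2 ^ k * #|closing_pairs ((k + r).*2.+3) false| <= D * N.
Proof.
set m := _.+3.
pose Q t := forall i, i < size t -> [set cpath t i; cpath t i.+1] \in B.
have le : (2 * D) ^ size (iota 2 m.-2) * #|closing_pairs m false| <= (\prod_(i < m.-1) D) * N.
  apply: (@card_closing_pairs m false Q (fun=> D)) => //.
  - exact: iota_uniq.
  - by move=> i; rewrite mem_iota.
  - move=> t x Qx i it; have := Qx i; rewrite size_rcons ltnS => /(_ (ltnW it)).
    by rewrite !cpath_rcons // ltnW.
  - move=> t _; apply: leq_trans (card_new_nbr (cpath t (size t))).
    apply/subset_leq_card/subsetP => x; rewrite in_set [in X in _ -> X]in_set => /asboolP Qx.
    have := Qx (size t); rewrite size_rcons => /(_ (leqnn _)).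
    by rewrite cpath_rcons // cpath_last.
  move=> t h a b tm hW [_ _ _ pm hp]; case: b hp => [//|c] hp _.
  have nc i : i < m -> [set cpath t i; cpath t i.+1] \in H'.
    move=> im; have := hp i im; rewrite /alt.
    by case: (odd i) => hi; apply: (completion_new hW hi).
  split=> [i it|i]; last by rewrite mem_iota => /andP[_ im]; apply: nc.
  by apply: (subsetP H'B); apply: nc; rewrite tm in it; apply: ltn_trans it _.
move: le; rewrite size_iota prod_nat_const card_ord expnMn -[m.-2]/((k + r).*2.+1).
set w := _.*2.+1; rewrite -[m.-1]/(w.+1) => le.
have w0 : 0 < D ^ w by rewrite expn_gt0 D_gt0.
have kw : 2 ^ k <= 2 ^ w.
  by rewrite leq_exp2l // /w -addnn -addnA -addnS leq_addr.
rewrite -(leq_pmul2l w0) mulnA [D ^ w * (D * N)]mulnA -expnSr.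
by apply: leq_trans le; rewrite leq_mul2r mulnC leq_mul2r kw !orbT.
Qed.

Lemma card_closing : #|[set x | (x.1 \in completions H') &&
    `[< exists b p m, closing_path x.1 (inr x.2) b u v p m >]]| <= 4 * D * N.
Proof.
pose X k := closing_pairs ((k + r).*2.+3) true :|: closing_pairs ((k + r).*2.+3) false.
apply: (@leq_trans #|\bigcup_(k < #|G|) X k|).
  apply/subset_leq_card/subsetP => x; rewrite inE => /andP[xW /asboolP[b [p [m cl]]]].
  have sx E : x.1 E <> None -> E \in edges G by apply: completion_supp xW.
  have eG : e \in edges G by have := subsetP HB _ eH; rewrite inE => /andP[].
  have rm := closing_path_size sx eG eE longG cl.
  have [[om _] inj _ _ _] := cl.
  have mG : m.+1 <= #|G|.
    rewrite -[m.+1]card_ord; apply: (@leq_card _ _ (fun i : 'I_m.+1 => p i)) => i j /inj ij.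
    by apply/val_inj/ij.
  (* m is odd and at least 2 * r + 3, because of the girth *)
  have mE : m = (((m - 3)./2 - r) + r).*2.+3.
    have := odd_double_half m; rewrite om -!muln2 => mE.
    by clear -rm mE om; lia.
  have kG : (m - 3)./2 - r < #|G|.
    by apply: leq_trans mG; clear; lia.
  apply/bigcupP; exists (Ordinal kG) => //; rewrite in_setU /= -mE.
  case: b cl => c cl; apply/orP; [left|right]; rewrite inE xW /=; apply/asboolP.
    by exists (inl c), p.
  by exists (inr c), p.
have XP : \sum_(k < #|G|) #|X k| <= 2 * (2 * D * N).
  apply: (@sum_geometric (fun k => #|X k|)) => k _.
  have := leq_add (card_mixed k) (card_pure k).
  rewrite -mulnDr addnn -[leqRHS]mul2n mulnA; apply: leq_trans.
  by rewrite leq_mul2l leq_card_setU orbT.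
rewrite -[4]/(2 * 2) -!mulnA; rewrite -mulnA in XP; apply: leq_trans XP.
elim/big_rec2: _ => [|k n S _ le]; first by rewrite cards0.
by rewrite (leq_trans (leq_card_setU _ _)) // leq_add2l.
Qed.

Lemma card_conflict w h : h \in completions H' ->
  #|[set a : 'I_M | [exists x, h [set w; x] == Some (inr a)]]| <= D.
Proof.
move=> hW; apply: leq_trans (card_new_nbr w).
apply: card_colors_at => [a b []//|y a hy].
by rewrite inE (subsetP H'B) // (completion_new hW hy).
Qed.

(** Among the 8 D new colors, 2 D are lost to properness and, on average, at most
4 D to bicolored cycles. *)
Lemma completions_step : 2 * D * N <= #|completions H|.
Proof.
pose good h a := h \in completions H' /\ recolor h e (Some (inr a)) \in completions H.
pose Xg := [set x : {ffun {set G} -> option CC} * 'I_M | `[< good x.1 x.2 >]].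
pose Xc := [set x : {ffun {set G} -> option CC} * 'I_M | (x.1 \in completions H') &&
    `[< exists b p m, closing_path x.1 (inr x.2) b u v p m >]].
pose Xv w := [set x : {ffun {set G} -> option CC} * 'I_M | (x.1 \in completions H') &&
    [exists y, x.1 [set w; y] == Some (inr x.2)]].
have cg : #|Xg| <= #|completions H|.
  rewrite -(@card_in_imset _ _ (fun x => recolor x.1 e (Some (inr x.2)))).
    by apply/subset_leq_card/subsetP => h /imsetP[x]; rewrite inE => /asboolP[_ ?] ->.
  move=> [h a] [h' a']; rewrite !inE => /asboolP[/= hW _] /asboolP[/= hW' _] /ffunP eqh.
  have := eqh e; rewrite !recolorE => -[<-]; congr (_, _); apply/ffunP => E.
  have [->|En] := eqVneq E e; last by have := eqh E; rewrite !recolor_neq.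
  have eH' : e \notin H' by rewrite !inE eqxx.
  by move/completionsP: hW => [_ _ _ ->] //; move/completionsP: hW' => [_ _ _ ->].
have cv w : #|Xv w| <= D * N.
  rewrite mulnC -sum_nat_const.
  rewrite (card_dep_pairs _ (fun h a => [exists y, h [set w; y] == Some (inr a)])).
  by apply: leq_sum => h; apply: card_conflict.
have cover : setX (completions H') [set: 'I_M] \subset Xg :|: (Xc :|: (Xv u :|: Xv v)).
  apply/subsetP => -[h a]; rewrite in_setX in_setT andbT => /= hW.
  rewrite !in_setU.
  case Eu : (_ \in Xv u); first by rewrite !orbT.
  case Ev : (_ \in Xv v); first by rewrite !orbT.
  case Ec : (_ \in Xc); first by rewrite !orbT.
  rewrite !orbF inE; apply/asboolP; split=> //=.
  move: Eu; rewrite inE hW /= => Eu; move: Ev; rewrite inE hW /= => Ev.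
  move: Ec; rewrite inE hW /= => /asboolP Ec.
  have [ph ah hn ho] := completionsP _ _ hW.
  apply/completionsP; split.
  - rewrite eE; apply: proper_recolor => // x hx.
      by move/negbT/existsPn: Eu => /(_ x); rewrite hx eqxx.
    by move/negbT/existsPn: Ev => /(_ x); rewrite hx eqxx.
  - rewrite eE; apply: acyclic_recolor => // b p m cl.
    by apply: Ec; exists b, p, m.
  - move=> E EH; have [->|En] := eqVneq E e; first by exists a; rewrite recolorE.
    by rewrite recolor_neq //; apply: hn; rewrite !inE En.
  move=> E EH; have En : E != e by apply: contraNneq EH => ->.
  by rewrite recolor_neq // ho // !inE En.
have := subset_leq_card cover; rewrite cardsX cardsT card_ord -/N.
have := (leq_card_setU Xg (Xc :|: (Xv u :|: Xv v))).1.
have := (leq_card_setU Xc (Xv u :|: Xv v)).1.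
have := (leq_card_setU (Xv u) (Xv v)).1.
have cc : #|Xc| <= 4 * D * N := card_closing.
move: cg cc (cv u) (cv v); rewrite /M.
move: #|_ :|: (_ :|: (_ :|: _))| #|Xc :|: _| #|Xv u :|: _| #|Xg| #|Xc| #|Xv u| #|Xv v|.
move: #|completions H| => c; move: (N) (D) c; clear; nia.
Qed.

End OneNewColor.

Theorem completion_exists : exists h : {ffun {set G} -> option CC},
  [/\ proper_partial h, acyclic_partial h & forall E, E \in edges G -> h E <> None].
Proof.
have N0 : 0 < #|completions set0|.
  apply/card_gt0P; exists [ffun E => old (f0 E)]; apply/completionsP; split.
  - move=> x y z c; rewrite !ffunE.
    case fx : (f0 _) => [a|//]; case fy : (f0 _) => [b|//] /= [<-] [ab].
    by rewrite ab in fy; apply: pf0 fx fy.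
  - move=> a b p n n2 en inj fp.
    have old0 i : i < n -> exists c, f0 [set p i; p (i.+1 %% n)] = Some c /\ alt a b i = inl c.
      by move=> /fp; rewrite ffunE; case: (f0 _) => //= c [<-]; exists c.
    have [b' [_ bb]] := old0 0 (ltnW (ltnW n2)).
    have [a' [_ aa]] := old0 1 (ltnW n2).
    apply: (af0 (a := a') (b := b') n2 en inj) => i iN; have [c [-> +]] := old0 i iN.
    rewrite /alt in aa bb *; rewrite /= in aa bb; rewrite aa bb.
    by case: ifP => _ [->].
  - by move=> E; rewrite inE.
  by move=> E _; rewrite ffunE.
have step (H : {set {set G}}) e : H \subset B -> e \in H ->
    (forall A : {set {set G}}, A \subset H :\ e ->
      (2 * D) ^ #|A| * #|completions ((H :\ e) :\: A)| <= #|completions (H :\ e)|) ->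
    2 * D * #|completions (H :\ e)| <= #|completions H|.
  move=> HB eH IH; have := subsetP HB _ eH; rewrite inE => /andP[eG _].
  have [u [v eE]] := edgesP eG.
  exact: (completions_step HB eH eE IH).
have := growth step (subxx B) (subxx B).
rewrite setDv => le; have : 0 < #|completions B|.
  by apply: leq_trans le; rewrite muln_gt0 expn_gt0 muln_gt0 D_gt0 N0.
case/card_gt0P => h hB; have [ph ah hn ho] := completionsP _ _ hB.
exists h; split=> // E EG; case EB : (E \in B); first by have [a ->] := hn E EB.
rewrite ho ?EB //; move: EB; rewrite inE EG /=; by case: (f0 E).
Qed.

End Completion.

(** * Cutting an alternating path *)

Section CutInjectivity.
Variables (G : sgraph) (C : eqType).
Implicit Types (f g h : {ffun {set G} -> option C}) (p q : nat -> G).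

Lemma closing_path_cut f a b u v p m i k : closing_path f a b u v p m ->
  i < m -> k < m -> k != i ->
  erase [set [set p i; p i.+1]] f [set p k; p k.+1] = Some (alt a b k).
Proof.
move=> [_ inj _ _ fp] im km ki; rewrite ffunE !inE; case: eqP => [|_]; last exact: fp.
by move=> /(path_edge_inj inj km im) kiE; rewrite kiE eqxx in ki.
Qed.

(** Up to the first cut, both paths follow the same colors in the same proper
coloring. *)
Lemma closing_path_cut_prefix f g a b u v p q m n i j :
  proper_partial f ->
  closing_path f a b u v p m -> closing_path g a b u v q n -> i < m -> j < n ->
  erase [set [set p i; p i.+1]] f = erase [set [set q j; q j.+1]] g ->
  forall k, k <= i -> k <= j -> p k = q k.
Proof.
move=> pf cp cq im jn E; have := cp; have := cq.
move=> [_ _ q0 _ _] [_ _ p0 _ _].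
elim=> [|k IHk] ki kj; first by rewrite p0.
have pk : p k = q k by apply: IHk; apply: ltnW.
have := closing_path_cut cp im (ltn_trans ki im) (negbT (ltn_eqF ki)).
have := closing_path_cut cq jn (ltn_trans kj jn) (negbT (ltn_eqF kj)).
by rewrite -E -pk => hq hp; apply: (proper_erase pf) hp hq.
Qed.

(** If p were cut first, the alternating path from u in the common cut coloring
would stop at p i because of p, and go on because of q. *)
Lemma closing_path_cut_le f g a b u v p q m n i j :
  proper_partial f -> proper_partial g ->
  closing_path f a b u v p m -> closing_path g a b u v q n -> i < m -> j < n ->
  erase [set [set p i; p i.+1]] f = erase [set [set q j; q j.+1]] g -> j <= i.
Proof.
move=> pf pg cp cq im jn E; rewrite leqNgt; apply/negP => ij.
have pi := closing_path_cut_prefix pf cp cq im jn E (leqnn i) (ltnW ij).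
have := closing_path_cut cq jn (ltn_trans ij jn) (negbT (ltn_eqF ij)).
rewrite -E -pi => hq; have := hq; rewrite ffunE !inE; case: eqP => // _ fq.
have [_ _ _ _ /(_ i im) fp] := cp; have pq := pf _ _ _ _ fp fq.
by move: hq; rewrite -pq ffunE inE eqxx.
Qed.

(** Following the colors b, a, b, ... from u as far as possible finds one end of
the cut edge, and doing so from v finds the other.  The color of the cut edge is
known from its position, so that the original coloring is restored.  Hence the
position of the cut need not be recorded, which is what makes long cycles
rare. *)
Lemma closing_path_cut_inj f g a b u v p q m n i j :
  proper_partial f -> proper_partial g ->
  closing_path f a b u v p m -> closing_path g a b u v q n -> i < m -> j < n ->
  erase [set [set p i; p i.+1]] f = erase [set [set q j; q j.+1]] g -> f = g /\ i = j.
Proof.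
move=> pf pg cp cq im jn E.
have ij : i = j.
  apply/eqP; rewrite eqn_leq (closing_path_cut_le pf pg cp cq im jn E) andbT.
  exact: (closing_path_cut_le pg pf cq cp jn im (esym E)).
subst j; split=> //.
have cp' := closing_path_rev cp; have cq' := closing_path_rev cq.
have rev_edge (r : nat -> G) l : i < l ->
    [set r (l - (l - i.+1)); r (l - (l - i.+1).+1)] = [set r i; r i.+1].
  by move=> il; rewrite setUC; congr [set r _; r _]; lia.
have lt l : i < l -> l - i.+1 < l by lia.
have E' : erase [set [set p (m - (m - i.+1)); p (m - (m - i.+1).+1)]] f =
          erase [set [set q (n - (n - i.+1)); q (n - (n - i.+1).+1)]] g.
  by rewrite !rev_edge.
have mn : m = n.
  have := closing_path_cut_le pf pg cp' cq' (lt _ im) (lt _ jn) E'.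
  have := closing_path_cut_le pg pf cq' cp' (lt _ jn) (lt _ im) (esym E').
  lia.
subst n.
have pi := closing_path_cut_prefix pf cp cq im jn E (leqnn i) (leqnn i).
have := closing_path_cut_prefix pf cp' cq' (lt _ im) (lt _ im) E' (leqnn _) (leqnn _).
rewrite /= subKn // => pi1.
have [_ _ _ _ /(_ i im) fp] := cp; have [_ _ _ _ /(_ i im) gq] := cq.
apply/ffunP => F; move/ffunP/(_ F): E; rewrite !ffunE !inE -pi -pi1.
by case: eqP => // -> _; rewrite fp pi pi1 gq.
Qed.

End CutInjectivity.

(** * Colorings with few blank edges *)

Section NeighborhoodBalls.
Variable G : sgraph.

Fixpoint nbr_ball (u : G) (n : nat) : {set G} :=
  if n is n.+1 then \bigcup_(y in nbr_ball u n) (y |: [set z | adj y z]) else [set u].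

Lemma card_nbr_ball u n : #|nbr_ball u n| <= (max_degree G).+1 ^ n.
Proof.
elim: n => [|n IHn]; first by rewrite cards1.
rewrite expnSr; apply: (@leq_trans (\sum_(y in nbr_ball u n) (max_degree G).+1)).
  rewrite /=; elim/big_rec2: _ => [|y k S _ le]; first by rewrite cards0.
  apply: leq_trans (leq_card_setU _ _) _; apply: leq_add le.
  rewrite cardsU1 -add1n; apply: leq_add (card_nbr y); exact: leq_b1.
by rewrite sum_nat_const leq_mul2r IHn orbT.
Qed.

Lemma nbr_ball_mono u n k : n <= k -> nbr_ball u n \subset nbr_ball u k.
Proof.
move=> /subnK<-; elim: (k - n) => [|j IHj] //=.
apply: subset_trans IHj _; apply/subsetP => y yB; apply/bigcupP; exists y => //.
by rewrite !inE eqxx.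
Qed.

Lemma nbr_ball_path (p : nat -> G) n : (forall i, i < n -> adj (p i) (p i.+1)) ->
  p n \in nbr_ball (p 0) n.
Proof.
elim: n => [|n IHn] pp; first by rewrite inE.
apply/bigcupP; exists (p n); first by apply: IHn => i iN; apply: pp; apply: ltnW.
by rewrite !inE pp ?orbT.
Qed.

End NeighborhoodBalls.

(** The final estimate of [weight_closing]: S, Ss and Su are the weights of the
colorings with a closing path, of the forbidden cuts and of the allowed ones. *)
Lemma cut_arith (lambda L K beta B P S Ss Su Zt : nat) :
  0 < lambda -> 0 < L -> 2 * K ^ 2 <= lambda * L * beta -> 2 * K * B <= beta * P ->
  0 < P -> lambda * Su <= K ^ 2 * Zt -> P * Ss <= B * (K * L * Zt) -> L * S <= Ss + Su ->
  S <= beta * Zt.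
Proof.
move=> l0 L0 h1 h2 P0 h3 h4 h5.
have w0 : 0 < 2 * (lambda * L * P) by rewrite !muln_gt0 l0 L0 P0.
rewrite -(leq_pmul2l w0).
have := leq_mul (leqnn (2 * lambda * P)) h5.
have := leq_mul (leqnn (2 * lambda)) h4.
have := leq_mul (leqnn (2 * P)) h3.
have := leq_mul (leqnn (P * Zt)) h1.
have := leq_mul (leqnn (lambda * L * Zt)) h2.
by move: (K ^ 2) => K2; clear; lia.
Qed.

Section BlankColorings.
Variables (G : sgraph) (beta lambda D L : nat).
Let Delta := max_degree G.
Let K := 2 * Delta + 2 * beta.
Hypothesis beta_gt0 : 0 < beta.
Hypothesis lambda_gt0 : 0 < lambda.
Hypothesis L_gt0 : 0 < L.
Hypothesis longG : forall s : seq G, is_cycle s -> L.+1 <= size s.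
(* many_cuts and small_ball each account for half of the beta bad colors *)
Hypothesis many_cuts : 2 * K ^ 2 <= lambda * L * beta.
Hypothesis few_saturated : 2 ^ (2 * Delta) * lambda ^ D <= beta ^ D.
Hypothesis small_ball : 2 * K * Delta.+1 ^ L <= beta * 2 ^ Delta.

Implicit Types (H A : {set {set G}}) (f : {ffun {set G} -> option 'I_K}).

Definition blank H f : {set {set G}} := [set E in H | f E == None].
Definition blank_at H f (x : G) : {set {set G}} := [set E in blank H f | x \in E].

(** The value None means blank on H and absent elsewhere.  So a coloring of H
that is blank on A becomes a coloring of H - A without any change. *)
Definition blank_colorings H : {set {ffun {set G} -> option 'I_K}} :=
  [set f | [&& `[< proper_partial f /\ acyclic_partial f >],
     [forall E, (f E != None) ==> (E \in H)] & [forall x, #|blank_at H f x| <= D]]].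

Definition weight H f := lambda ^ #|blank H f|.
Definition Z H := \sum_(f in blank_colorings H) weight H f.

Lemma blank_coloringsP H f : reflect
  [/\ proper_partial f, acyclic_partial f,
      forall E, f E <> None -> E \in H & forall x, #|blank_at H f x| <= D]
  (f \in blank_colorings H).
Proof.
rewrite inE; apply: (iffP and3P) => [[/asboolP[pf af] /forallP fH /forallP fD]|[pf af fH fD]].
  by split=> // E /eqP fE; apply: (implyP (fH E)).
split; [exact/asboolP|apply/forallP => E|exact/forallP].
by apply/implyP => /eqP; apply: fH.
Qed.

Section Saturation.
Variable H : {set {set G}}.
Hypothesis HG : H \subset edges G.
Hypothesis IH : forall A, A \subset H -> beta ^ #|A| * Z (H :\: A) <= Z H.

(** A coloring of H that is blank on A is also a coloring of H - A, where its
weight lacks the factor lambda for each edge of A. *)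
Lemma weight_blank A : A \subset H ->
  \sum_(f in blank_colorings H | A \subset blank H f) weight H f
    <= lambda ^ #|A| * Z (H :\: A).
Proof.
move=> AH; rewrite big_distrr /=.
apply: (@leq_sum_inj _ _ _ _ _ (fun f => lambda ^ #|A| * weight (H :\: A) f) id) => [//|f|f].
  rewrite unfold_in /= => /andP[/blank_coloringsP[pf af fH fD] /subsetP AB].
  apply/blank_coloringsP; split=> // [E fE|x].
    rewrite inE fH // andbT; apply/negP => /AB; rewrite inE => /andP[_ /eqP]; exact: fE.
  apply: leq_trans (fD x); apply/subset_leq_card/subsetP => E.
  by rewrite !inE => /andP[/andP[/andP[_ ->] ->] ->].
rewrite unfold_in /= => /andP[_ AB]; rewrite /weight -expnD leq_eqVlt; apply/orP; left.
rewrite -(cardsID A (blank H f)) (setIidPr AB); apply/eqP; congr (_ ^ (_ + #|pred_of_set _|)).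
by apply/setP => E; rewrite !inE andbA.
Qed.

(** There are at most 2 ^ Delta sets A of D edges at x.  Being blank on A costs the
factor (lambda / beta) ^ D, which is at most 4 ^ (- Delta) by the choice of
lambda. *)
Lemma weight_saturated x :
  2 ^ Delta * (\sum_(f in blank_colorings H | D <= #|blank_at H f x|) weight H f) <= Z H.
Proof.
pose SA := [set A in powerset (H :&: star x) | #|A| == D].
have cSA : #|SA| <= 2 ^ Delta.
  apply: (@leq_trans #|powerset (H :&: star x)|).
    by apply/subset_leq_card/subsetP => A; rewrite inE => /andP[].
  rewrite card_powerset leq_exp2l //; apply: leq_trans (card_star x).
  by apply/subset_leq_card/subsetIr.
have le : \sum_(f in blank_colorings H | D <= #|blank_at H f x|) weight H f <=
    \sum_(A in SA) \sum_(f in blank_colorings H | A \subset blank H f) weight H f.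
  rewrite (exchange_big_dep (mem (blank_colorings H))) /=; last by move=> A f _ /andP[].
  rewrite big_mkcondr; apply: leq_sum => f fH; case: ifP => // Df.
  have [_ _ _ /(_ x) fD] := blank_coloringsP _ _ fH.
  rewrite (bigD1 (blank_at H f x)) /= ?leq_addr //; apply/andP; split.
    rewrite inE powersetE eqn_leq fD Df !andbT; apply/subsetP => E; rewrite !inE.
    move=> /andP[/andP[EH _] xE]; rewrite EH xE andbT /=.
    by have := subsetP HG _ EH; rewrite inE.
  by rewrite fH /=; apply/subsetP => E; rewrite inE => /andP[].
have bD : 0 < beta ^ D by rewrite expn_gt0 beta_gt0.
rewrite -(leq_pmul2l bD).
have {}le : beta ^ D * (\sum_(f in blank_colorings H | D <= #|blank_at H f x|) weight H f) <=
   2 ^ Delta * lambda ^ D * Z H.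
  apply: leq_trans (leq_mul (leqnn _) le) _; rewrite big_distrr /=.
  apply: (@leq_trans (\sum_(A in SA) lambda ^ D * Z H)); last first.
    by rewrite sum_nat_const mulnA leq_mul2r leq_mul2r cSA !orbT.
  apply: leq_sum => A; rewrite inE => /andP[]; rewrite inE subsetI => /andP[AH _] /eqP AD.
  apply: leq_trans (leq_mul (leqnn _) (weight_blank AH)) _.
  by have := IH AH; rewrite AD mulnCA leq_mul2l => ->; rewrite orbT.
rewrite mulnCA; apply: leq_trans (leq_mul (leqnn _) le) _.
by rewrite !mulnA leq_mul2r -expnD addnn -mul2n few_saturated orbT.
Qed.

End Saturation.

Section ColoringOneEdge.
Variables (H : {set {set G}}) (e : {set G}) (u v : G).
Hypothesis HG : H \subset edges G.
Hypothesis eH : e \in H.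
Hypothesis eE : e = [set u; v].
Let H' := H :\ e.
Hypothesis IH : forall A, A \subset H' -> beta ^ #|A| * Z (H' :\: A) <= Z H'.

Let H'G : H' \subset edges G. Proof. by apply: subset_trans HG; exact: subsetDl. Qed.

Let state := ({ffun {set G} -> option 'I_K} * 'I_K)%type.
Let closable (x : state) (b : 'I_K) p m := closing_path x.1 x.2 b u v p m.

Definition closing_states : {set state} :=
  [set x : state | (x.1 \in blank_colorings H') && `[< exists b p m, closable x b p m >]].

Definition saturated (x : G) (f : {ffun {set G} -> option 'I_K}) := D <= #|blank_at H' f x|.

Lemma closing_state_long x b p m : x \in closing_states -> closable x b p m -> L <= m.
Proof.
rewrite inE => /andP[/blank_coloringsP[_ _ fH' _] _] cl.
have sf E : x.1 E <> None -> E \in edges G by move=> /fH'; apply: subsetP.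
exact: (closing_path_size sf (subsetP HG _ eH) eE longG cl).
Qed.

Lemma weight_erase f E : f E <> None -> E \in H' ->
  weight H' (erase [set E] f) = lambda * weight H' f.
Proof.
move=> fE EH'; rewrite /weight -expnS; congr (_ ^ _).
have -> : blank H' (erase [set E] f) = E |: blank H' f.
  apply/setP => F; rewrite in_setU1 [LHS]inE [X in _ || X]inE ffunE in_set1.
  by case: (F =P E) => [->|_] //=; rewrite EH'.
by rewrite cardsU1 inE; case: eqP fE; rewrite ?andbF.
Qed.

Lemma erase_blank_coloring f x y : f \in blank_colorings H' ->
  f [set x; y] <> None -> ~~ saturated x f -> ~~ saturated y f ->
  erase [set [set x; y]] f \in blank_colorings H'.
Proof.
move=> /blank_coloringsP[pf af fH' fD] fxy sx sy.
apply/blank_coloringsP; split; [exact: proper_erase|exact: acyclic_erase| |] => [E|z].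
  by rewrite ffunE; case: ifP => // _; apply: fH'.
case zE : (z \in [set x; y]).
  have le : #|blank_at H' (erase [set [set x; y]] f) z| <= #|blank_at H' f z|.+1.
    apply: (@leq_trans #|[set x; y] |: blank_at H' f z|).
      apply/subset_leq_card/subsetP => F; rewrite in_setU1.
      case: (F =P [set x; y]) => //= /eqP Fn.
      by rewrite !inE ffunE in_set1 (negPf Fn).
    by rewrite cardsU1 -add1n leq_add2r leq_b1.
  apply: leq_trans le _; move: zE; rewrite ltnNge !inE => /orP[] /eqP->; [exact: sx|exact: sy].
apply: leq_trans (fD z); apply/subset_leq_card/subsetP => F.
have [->|Fn] := eqVneq F [set x; y]; first by rewrite inE zE andbF.
by rewrite !inE ffunE in_set1 (negPf Fn).
Qed.

(** Each coloring with a closing path is cut at each of the first L edges of that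
path.  A cut multiplies the weight by lambda, and a cut coloring together with
the two colors comes from a single cut.  A cut is forbidden only if an end of
the cut edge has D blank edges; this end is at distance at most L from u. *)
Lemma weight_closing : \sum_(x in closing_states) weight H' x.1 <= beta * Z H'.
Proof.
(* w x consists of the color b, the path and its number of edges *)
have /choice[w wP] : forall x : state, exists w : 'I_K * ((nat -> G) * nat),
    x \in closing_states -> closable x w.1 w.2.1 w.2.2.
  move=> x.
  have [xc|xc] := boolP (x \in closing_states).
    by move: (xc); rewrite inE => /andP[_ /asboolP[b [p [m cl]]]]; exists (b, (p, m)).
  by exists (x.2, (fun=> u, 0)).
(* the ends of the edge that is cut are pt x 0 and pt x 1 *)
pose pt (x : state * 'I_L) i := (w x.1).2.1 (x.2 + i).
pose all_cuts := setX closing_states [set: 'I_L].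
pose sat (x : state * 'I_L) := saturated (pt x 0) x.1.1 || saturated (pt x 1) x.1.1.
have cutP x : x \in all_cuts -> (x.2 : nat) < (w x.1).2.2.
  by rewrite in_setXT => xc; apply: leq_trans (ltn_ord _) (closing_state_long xc (wP _ xc)).
have total : L * (\sum_(x in closing_states) weight H' x.1) =
    \sum_(x in all_cuts) weight H' x.1.1.
  by rewrite (sum_setXT _ _ (fun y : state => weight H' y.1)) card_ord.
have split_cuts : all_cuts \subset [set x in all_cuts | sat x] :|: [set x in all_cuts | ~~ sat x].
  by apply/subsetP => x xc; rewrite in_setU [X in X || _]inE [X in _ || X]inE xc; case: (sat x).
have unsat : lambda * (\sum_(x in [set x in all_cuts | ~~ sat x]) weight H' x.1.1) <= K ^ 2 * Z H'.
  rewrite big_distrr /=.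
  pose Y := setX (blank_colorings H') [set: 'I_K * 'I_K].
  apply: (@leq_trans (\sum_(y in Y) weight H' y.1)); last first.
    by rewrite (sum_setXT _ _ (weight H')) card_prod card_ord.
  pose cut (x : state * 'I_L) := (erase [set [set pt x 0; pt x 1]] x.1.1, (x.1.2, (w x.1).1)).
  have colored x : x \in all_cuts -> x.1.1 [set pt x 0; pt x 1] <> None.
    move=> xa; move: (xa); rewrite in_setXT => /wP[_ _ _ _ /(_ _ (cutP _ xa))].
    by rewrite /pt addn0 addn1 => ->.
  have inB (x : state * 'I_L) : x \in all_cuts -> x.1.1 \in blank_colorings H'.
    by rewrite in_setXT => xc; move: xc; rewrite inE => /andP[].
  apply: (@leq_sum_inj _ _ _ _ _ (fun y => weight H' y.1) cut).
  - move=> x y; rewrite inE => /andP[xa _]; rewrite inE => /andP[ya _].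
    rewrite /cut /pt !addn0 !addn1 => -[E a2 b2].
    have [pf _ _ _] := blank_coloringsP _ _ (inB _ xa).
    have [pg _ _ _] := blank_coloringsP _ _ (inB _ ya).
    have ix := cutP _ xa; have iy := cutP _ ya.
    move: xa ya; rewrite !in_setXT => /wP cx /wP cy.
    rewrite /closable -a2 -b2 in cy.
    have [fg ij] := closing_path_cut_inj pf pg cx cy ix iy E.
    clear -a2 fg ij; case: x y a2 fg ij => [[f a] i] [[g b] j] /= <- -> /val_inj->.
    by [].
  - move=> x; rewrite inE => /andP[xa]; rewrite negb_or => /andP[s0 s1].
    rewrite in_setXT; apply: erase_blank_coloring => //; first exact: inB.
    exact: colored.
  move=> x; rewrite inE => /andP[xa _]; rewrite weight_erase //; first exact: colored.
  have [_ _ fH' _] := blank_coloringsP _ _ (inB _ xa).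
  exact/fH'/colored.
have satu : 2 ^ Delta * (\sum_(x in [set x in all_cuts | sat x]) weight H' x.1.1) <=
    Delta.+1 ^ L * (K * L * Z H').
  pose P (x : state * 'I_L) (z : G) := (x.1.1 \in blank_colorings H') && saturated z x.1.1.
  apply: (@leq_trans (2 ^ Delta * \sum_(z in nbr_ball u L) \sum_(x | P x z) weight H' x.1.1)).
    rewrite leq_mul2l; apply/orP; right; apply: leq_sum_cover => x.
    rewrite inE => /andP[xa sx]; have xc : x.1 \in closing_states by move: xa; rewrite in_setXT.
    have xB : x.1.1 \in blank_colorings H' by move: xc; rewrite inE => /andP[].
    have [_ _ fH' _] := blank_coloringsP _ _ xB.
    have [_ _ p0 _ fp] := wP _ xc; have ix := cutP _ xa.
    have ptB i : i <= 1 -> pt x i \in nbr_ball u L.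
      move=> i1; have iL : x.2 + i <= L.
        by apply: leq_trans (ltn_ord x.2); rewrite -addn1 leq_add2l.
      apply: (subsetP (nbr_ball_mono u iL)); rewrite /pt -p0; apply: nbr_ball_path => k ki.
      rewrite -in_edges; apply: (subsetP H'G); apply: fH'; rewrite fp //.
      apply: leq_trans ki _; apply: leq_trans ix; rewrite -addn1 leq_add2l //.
    by case/orP: sx => sx; [exists (pt x 0)|exists (pt x 1)]; rewrite ?ptB // /P xB.
  rewrite big_distrr /=; apply: (@leq_trans (\sum_(z in nbr_ball u L) (K * L * Z H'))); last first.
    by rewrite sum_nat_const leq_mul2r card_nbr_ball orbT.
  apply: leq_sum => z _.
  pose bad := [set f in blank_colorings H' | saturated z f].
  rewrite (eq_bigl (mem (setX (setX bad [set: 'I_K]) [set: 'I_L]))); last first.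
    by move=> x; rewrite /= !in_setXT inE.
  rewrite (sum_setXT _ _ (fun y : state => weight H' y.1)) (sum_setXT _ _ (weight H')).
  have -> : \sum_(f in bad) weight H' f =
      \sum_(f in blank_colorings H' | D <= #|blank_at H' f z|) weight H' f.
    by apply: eq_bigl => f; rewrite inE.
  rewrite !card_ord; apply: leq_trans (leq_mul (leqnn (K * L)) (weight_saturated H'G IH z)).
  by move: (2 ^ Delta) (\sum_(f in _ | _) _) => c S; clear; lia.
have le := leq_trans (leq_sum_sub (fun x => weight H' x.1.1) split_cuts) (leq_sum_setU _ _ _).
rewrite -total in le.
exact: (cut_arith lambda_gt0 L_gt0 many_cuts small_ball (expn_gt0 2 Delta) unsat satu le).
Qed.

Lemma weight_conflict y :
  \sum_(x in [set x : state | (x.1 \in blank_colorings H') &&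
      [exists z, x.1 [set y; z] == Some x.2]]) weight H' x.1 <= Delta * Z H'.
Proof.
rewrite (sum_dep_pairs _
  (fun (h : {ffun {set G} -> option 'I_K}) a => [exists z, h [set y; z] == Some a])).
rewrite big_distrr /=; apply: leq_sum => f fH; rewrite mulnC leq_mul2r; apply/orP; right.
apply: leq_trans (card_nbr y); apply: card_colors_at => [a b //|z a fa].
have [_ _ fH' _] := blank_coloringsP _ _ fH.
by rewrite inE -in_edges; apply: (subsetP H'G); apply: fH'; rewrite fa.
Qed.

(** Of the 2 Delta + 2 beta colors, 2 Delta are lost to properness and, on average,
at most beta to bicolored cycles. *)
Lemma weight_step : beta * Z H' <= Z H.
Proof.
pose good (x : state) := x.1 \in blank_colorings H' /\
  recolor x.1 e (Some x.2) \in blank_colorings H.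
pose Xg := [set x : state | `[< good x >]].
pose Xv y := [set x : state | (x.1 \in blank_colorings H') &&
    [exists z, x.1 [set y; z] == Some x.2]].
have e_none f : f \in blank_colorings H' -> f e = None.
  move=> /blank_coloringsP[_ _ fH' _]; case fe : (f e) => [a|//].
  by have : e \in H' by [apply: fH'; rewrite fe]; rewrite setD11.
have blankE f a : blank H (recolor f e (Some a)) = blank H' f.
  apply/setP => F; have [->|Fn] := eqVneq F e; first by rewrite !inE recolorE eqxx andbF.
  by rewrite !inE recolor_neq // Fn.
have wg : \sum_(x in Xg) weight H' x.1 <= Z H.
  apply: (@leq_sum_inj _ _ _ _ _ (weight H) (fun x => recolor x.1 e (Some x.2))).
  - move=> [f a] [g b]; rewrite !inE => /asboolP[/= fB _] /asboolP[/= gB _] /ffunP E.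
    have := E e; rewrite !recolorE => -[<-]; congr (_, _); apply/ffunP => F.
    have [->|Fn] := eqVneq F e; first by rewrite !e_none.
    by have := E F; rewrite !recolor_neq.
  - by move=> x; rewrite inE => /asboolP[].
  by move=> x _; rewrite /weight blankE.
have cover : setX (blank_colorings H') [set: 'I_K] \subset
    Xg :|: (closing_states :|: (Xv u :|: Xv v)).
  apply/subsetP => -[f a]; rewrite in_setXT => /= fB.
  rewrite !in_setU.
  case Eu : (_ \in Xv u); first by rewrite !orbT.
  case Ev : (_ \in Xv v); first by rewrite !orbT.
  case Ec : (_ \in closing_states); first by rewrite !orbT.
  rewrite !orbF inE; apply/asboolP; split=> //=.
  move: Eu; rewrite inE fB /= => Eu; move: Ev; rewrite inE fB /= => Ev.
  move: Ec; rewrite inE fB /= => /asboolP Ec.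
  have [pf af fH' fD] := blank_coloringsP _ _ fB.
  apply/blank_coloringsP; split.
  - rewrite eE; apply: proper_recolor => // x hx.
      by move/negbT/existsPn: Eu => /(_ x); rewrite hx eqxx.
    by move/negbT/existsPn: Ev => /(_ x); rewrite hx eqxx.
  - rewrite eE; apply: acyclic_recolor => // b p m cl.
    by apply: Ec; exists b, p, m.
  - move=> E; have [->//|En] := eqVneq E e; rewrite recolor_neq // => /fH'.
    by rewrite inE => /andP[].
  by move=> x; rewrite /blank_at blankE; apply: fD.
have := leq_sum_sub (fun x => weight H' x.1) cover.
have -> : \sum_(x in setX (blank_colorings H') [set: 'I_K]) weight H' x.1 = K * Z H'.
  by rewrite (sum_setXT _ _ (weight H')) card_ord.
have l1 := leq_sum_setU Xg (closing_states :|: (Xv u :|: Xv v)) (fun x => weight H' x.1).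
have l2 := leq_sum_setU closing_states (Xv u :|: Xv v) (fun x => weight H' x.1).
have l3 := leq_sum_setU (Xv u) (Xv v) (fun x => weight H' x.1).
have l4 := leq_add (weight_conflict u) (weight_conflict v).
have l5 := leq_add weight_closing (leq_trans l3 l4).
have l6 := leq_add wg (leq_trans l2 l5).
move=> /leq_trans/(_ (leq_trans l1 l6)); rewrite /K mulnDl.
by move: (Z H') (Z H) Delta beta; clear; move=> z z' d b; lia.
Qed.

End ColoringOneEdge.

Theorem blank_coloring_exists : exists f : {ffun {set G} -> option 'I_K},
  [/\ proper_partial f, acyclic_partial f, forall E, f E <> None -> E \in edges G &
      forall x, #|[set E in [set E in edges G | f E == None] | x \in E]| <= D].
Proof.
have Z0 : 0 < Z set0.
  have f0 : [ffun=> None] \in blank_colorings set0.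
    apply/blank_coloringsP; split.
    - by move=> x y z c; rewrite ffunE.
    - move=> a b p n n2 _ _ /(_ 0); rewrite ffunE => fp.
      by have := fp (ltnW (ltnW n2)).
    - by move=> E; rewrite ffunE.
    move=> x; apply: leq_trans (leq0n _); rewrite leqn0 cards_eq0.
    by apply/eqP/setP => E; rewrite !inE.
  by rewrite /Z (bigD1 _ f0) /= addn_gt0 expn_gt0 lambda_gt0.
have step (H : {set {set G}}) e : H \subset edges G -> e \in H ->
    (forall A : {set {set G}}, A \subset H :\ e ->
      beta ^ #|A| * Z ((H :\ e) :\: A) <= Z (H :\ e)) -> beta * Z (H :\ e) <= Z H.
  move=> HG eH IH; have [u [v eE]] := edgesP (subsetP HG _ eH).
  exact: weight_step HG eH eE IH.
have := growth step (subxx (edges G)) (subxx _).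
rewrite setDv => le; have : 0 < Z (edges G).
  by apply: leq_trans le; rewrite muln_gt0 expn_gt0 beta_gt0.
rewrite lt0n /Z sum_nat_eq0 negb_forall => /existsP[f]; rewrite negb_imply => /andP[fB _].
by have [pf af fH fD] := blank_coloringsP _ _ fB; exists f.
Qed.

End BlankColorings.

(** * Choice of the parameters *)

(** Induction on the degree: the exponent m is split into two halves, one for the
polynomial of smaller degree and one for the additional factor. *)
Lemma exp_dominates_poly (L a : nat) :
  exists N, forall m, N <= m -> a * m.+1 ^ L <= 2 ^ m.
Proof.
elim: L a => [|L IH] a.
  exists a => m am; rewrite expn0 muln1; apply: leq_trans am _.
  exact: ltnW (ltn_expl m (isT : 1 < 2)).
have [N NP] := IH (a * 2 ^ L.+1); exists N.*2 => m Nm.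
set k := m./2; have mk : k.*2 <= m by rewrite -[leqRHS]odd_double_half leq_addl.
have mk1 : m.+1 <= 2 * k.+1 by rewrite -[m]odd_double_half /k; case: (odd m); lia.
have Nk : N <= k by rewrite /k; lia.
have e1 : m.+1 ^ L.+1 <= (2 * k.+1) ^ L.+1 by rewrite leq_exp2r.
apply: leq_trans (leq_mul (leqnn a) e1) _.
apply: (@leq_trans (2 ^ k * 2 ^ k)).
  rewrite expnMn [k.+1 ^ _]expnSr !mulnA; apply: leq_mul; first exact: NP.
  exact: (ltn_expl k (isT : 1 < 2)).
by rewrite -expnD addnn leq_exp2l.
Qed.

(** The second phase alone, starting from the coloring with all edges blank. *)
Lemma chromatic_index_crude (G : sgraph) :
  (forall s : seq G, is_cycle s -> 4 <= size s) ->
  acyclic_chromatic_index G <= 8 * (max_degree G).+1.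
Proof.
move=> longG.
have [|||E|x|||h [ph ah hE]] :=
    @completion_exists G void [ffun=> None] (max_degree G).+1 0.
- by [].
- by move=> x y z c; rewrite ffunE.
- move=> a b p n n2 _ _ /(_ 0); rewrite ffunE => fp.
  by have := fp (ltnW (ltnW n2)).
- by rewrite ffunE.
- apply: leq_trans (leqW (card_star x)); apply/subset_leq_card/subsetP => E.
  by rewrite !inE => /andP[/andP[-> _] ->].
- by rewrite expn0 mul1n.
- exact: longG.
by have := chromatic_index_le ph ah hE; rewrite card_sum card_void card_ord.
Qed.

(** With w = 4 ^ n and lambda about beta / w, the number (lambda / beta) ^ D is at
most 4 ^ (- n D), hence at most 4 ^ (- Delta).  As the number K of colors is at
most 4 n beta, and beta is at most 2 w lambda, the value of L makes
2 K ^ 2 <= lambda L beta.  The two summands of the girth are the demands of the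
two phases. *)
Lemma chromatic_index_large_girth (n : nat) : 0 < n ->
  exists c N, forall G : sgraph, N <= max_degree G ->
    (forall s : seq G, is_cycle s -> c <= size s) ->
    acyclic_chromatic_index G <= 2 * max_degree G + 10 * (max_degree G %/ n).+1.
Proof.
move=> n0; pose w := 2 ^ (2 * n); pose L := 64 * n ^ 2 * w.
have w0 : 0 < w by rewrite expn_gt0.
have [N1 N1P] := exp_dominates_poly L (8 * n).
exists (L.+1 + (2 * n + 4)), (N1 + n * w) => G.
set Delta := max_degree G; set beta := (Delta %/ n).+1; set lambda := beta %/ w.
move=> ND longG.
have D_lt : Delta < n * beta by rewrite mulnC -ltn_divLR.
have D_le : Delta <= n * beta by apply: ltnW.
have wb : w <= beta by rewrite /beta leqW // leq_divRL // mulnC; lia.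
have l0 : 0 < lambda by rewrite divn_gt0.
have lw : lambda * w <= beta by apply: leq_trunc_div.
have bl : beta <= 2 * (lambda * w).
  have := ltn_ceil beta w0; rewrite -/lambda mulSn.
  by have := leq_pmull w l0; lia.
have Kle : 2 * Delta + 2 * beta <= 4 * n * beta.
  by have := leq_pmull beta n0; lia.
have [||||||| f [pf af sf fD]] := @blank_coloring_exists G beta lambda beta L.
- by [].
- by [].
- by rewrite /L !muln_gt0 n0 w0.
- by move=> s /longG; apply: leq_trans; rewrite leq_addr.
- rewrite -/Delta; have := leq_mul Kle Kle; rewrite mulnn => K2.
  have := leq_mul (leqnn (32 * n ^ 2 * beta)) bl; rewrite /L.
  move: K2; move: (_ ^ 2) => K2; clear; nia.
- have lwD : (lambda * w) ^ beta <= beta ^ beta by rewrite leq_exp2r.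
  apply: leq_trans lwD; rewrite -/Delta mulnC expnMn leq_mul2l -expnM leq_exp2l //.
  by rewrite -mulnA leq_mul2l D_le !orbT.
- rewrite -/Delta; have NN : N1 <= Delta by apply: leq_trans ND; rewrite leq_addr.
  have := leq_mul (leqnn beta) (N1P _ NN); apply: leq_trans.
  have := leq_mul Kle (leqnn (2 * Delta.+1 ^ L)).
  by move: (Delta.+1 ^ L) => x; clear; lia.
have [||| h [ph ah hE]] := @completion_exists G _ f beta n _ pf af sf fD.
- by [].
- rewrite -/Delta; apply: leq_trans D_le _; rewrite leq_mul2r; apply/orP; right.
  exact: ltnW (ltn_expl n (isT : 1 < 2)).
- by move=> s /longG; apply: leq_trans; rewrite leq_addl.
have := chromatic_index_le ph ah hE; rewrite card_sum !card_ord => le.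
by apply: leq_trans le _; rewrite -/Delta -/beta; lia.
Qed.

(** * The asymptotic bound *)

Unset Implicit Arguments.
Import Order.TTheory GRing.Theory Num.Theory numFieldNormedType.Exports.
Local Open Scope classical_set_scope.
Local Open Scope ring_scope.

Lemma girth_le_size (R : realType) (G : sgraph) (c : nat) (s : seq G) :
  ((c%:R : R)%:E <= girth R G)%E -> is_cycle s -> (c <= size s)%N.
Proof.
move=> cg cs; rewrite -(ler_nat R) -lee_fin; apply: le_trans cg _.
by apply: ereal_inf_lbound; exists s.
Qed.

Theorem theorem5 (R : realType) (eps : R) (heps : 0 < eps) :
  exists (c : nat) (o : nat -> R),
    (o n / n%:R @[n --> \oo] --> (0 : R)) /\
    forall G : sgraph, ((c%:R : R)%:E <= girth R G)%E ->
      (acyclic_chromatic_index G)%:R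
        <= (2 + eps) * (max_degree G)%:R + o (max_degree G).
Proof.
pose n := (Num.truncn (10 / eps)).+1.
have [c [N large]] := @chromatic_index_large_girth n isT.
exists (c + 4)%N, (fun=> (8 * N.+1 + 10)%:R); split.
  rewrite -[X in _ --> X](mulr0 (8 * N.+1 + 10)%:R); apply: cvgMr.
  apply/gtr0_cvgV0; last exact: cvgr_idn.
  by near=> m; rewrite ltr0n; near: m; exact: nbhs_infty_gt.
move=> G gG; set Delta := max_degree G.
have long (s : seq G) : is_cycle s -> (c + 4 <= size s)%N.
  by move=> cs; exact (girth_le_size _ _ _ _ gG cs).
have [NG|GN] := leqP N Delta; last first.
  have := @chromatic_index_crude G (fun s cs => leq_trans (leq_addl _ _) (long s cs)).
  rewrite -(ler_nat R) => /le_trans; apply.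
  apply: (@le_trans _ _ (8 * N.+1 + 10)%:R).
    by rewrite ler_nat (leq_trans _ (leq_addr _ _)) // leq_mul2l ltnS ltnW // ltnW.
  by rewrite lerDr mulr_ge0 // addr_ge0 // ltW.
have := large G NG (fun s cs => leq_trans (leq_addr _ _) (long s cs)).
rewrite -(ler_nat R) => /le_trans; apply; rewrite -/Delta.
have n0 : (0 : R) < n%:R by rewrite ltr0n.
have epsn : 10 <= eps * n%:R.
  by rewrite -ler_pdivrMl // mulrC; apply: ltW; exact: truncnS_gt.
have quot : (10 * (Delta %/ n))%:R <= eps * Delta%:R.
  apply: (@le_trans _ _ (eps * n%:R * (Delta %/ n)%:R)).
    by rewrite natrM; apply: ler_wpM2r.
  by rewrite -mulrA -natrM ler_pM2l // ler_nat mulnC leq_trunc_div.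
rewrite mulnS addnCA natrD [X in _ + X <= _]natrD mulrDl [leRHS]addrC; apply: lerD.
  by rewrite ler_nat leq_addl.
by apply: lerD (quot); rewrite natrM.
Unshelve. all: by end_near.
Qed.
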